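(* A fullerene graph $F$ is 3-resonant if and only if it is $k$-resonant for every integer $k\ge 3$.
   Context: A fullerene graph is a 3-connected plane cubic graph with exactly 12 pentagonal faces and all other faces hexagonal. A set $\mathcal H$ of pairwise vertex-disjoint hexagonal faces of $F$ is a resonant pattern if $F$ has a perfect matching $M$ such that every hexagon in $\mathcal H$ is $M$-alternating (edges alternately in and off $M$), equivalently $F$ minus all vertices of the hexagons of $\mathcal H$ has a perfect matching. $F$ is $k$-resonant if every set of $i$ pairwise disjoint hexagons, for each $0\le i\le k$, is a resonant pattern. *)

(* Defs.v *)
From HB Require Import structures.
From mathcomp Require Import all_boot all_fingroup.

Set Implicit Arguments.
Unset Strict Implicit.
Unset Printing Implicit Defensive.

Record sgraph := SGraph {
  vertex :> finType;
  adj : rel vertex;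
  adj_sym : symmetric adj;
  adj_irr : irreflexive adj }.

Section SimpleGraph.

Variable G : sgraph.

Definition edges : {set {set G}} :=
  [set [set d.1; d.2] | d : G * G & adj d.1 d.2].

Definition cubic : Prop := forall x : G, #|[set y | adj x y]| = 3.

Definition adj_minus (S : {set G}) : rel G :=
  fun x y => [&& x \notin S, y \notin S & adj x y].

Definition connected_minus (S : {set G}) : Prop :=
  forall x y : G, x \notin S -> y \notin S -> connect (adj_minus S) x y.

Definition connected : Prop := connected_minus set0.

Definition k_connected (k : nat) : Prop :=
  k < #|G| /\ forall S : {set G}, #|S| < k -> connected_minus S.

Definition perfect_matching (M : {set {set G}}) : Prop :=
  M \subset edges /\ forall x : G, #|[set e in M | x \in e]| = 1.

(* A dart is an edge together with a direction, from its tail to its head. *)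
Definition dart : Type := {d : G * G | adj d.1 d.2}.
HB.instance Definition _ := SubFinite.on dart.

Definition dtail (d : dart) : G := (val d).1.
Definition dhead (d : dart) : G := (val d).2.
Definition edge_of (d : dart) : {set G} := [set dtail d; dhead d].

Lemma drev_subproof (d : dart) : adj (dhead d) (dtail d).
Proof. by rewrite adj_sym; exact: (valP d). Qed.

Definition drev (d : dart) : dart := Sub (dhead d, dtail d) (drev_subproof d).

Lemma drevK : involutive drev.
Proof. by move=> d; apply: val_inj; case: d => [[]]. Qed.

(* The boundary walks of an embedding with rotation r: from the dart (u, v)   *)
(* one continues with the dart that follows (v, u) in the rotation at v.      *)
Definition face_perm (r : {perm dart}) : {perm dart} :=
  (perm (inv_inj drevK) * r)%g.

End SimpleGraph.

(* Plane graphs are given combinatorially (Heffter-Edmonds): an embedding of  *)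
(* a connected graph in an oriented closed surface is determined, up to       *)
(* homeomorphism, by the cyclic order of the darts leaving each vertex; its   *)
(* faces are the orbits of [face_perm], and the surface is the sphere iff     *)
(* Euler's formula holds.  The one-vertex graph, which has a face but no      *)
(* dart, is not covered.                                                      *)
Record plane_graph := PlaneGraph {
  pg_graph :> sgraph;
  rotation : {perm dart pg_graph};
  dtail_rotation : forall d, dtail (rotation d) = dtail d;
  rotation_cyclic : forall d d', dtail d = dtail d' -> d' \in porbit rotation d;
  pg_connected : connected pg_graph;
  pg_euler :
    #|pg_graph| + #|porbits (face_perm rotation)| = #|edges pg_graph| + 2 }.

Section Fullerene.

Variable F : plane_graph.

Definition next_dart : {perm dart F} := face_perm (rotation F).

(* A face is the set of the darts of its boundary walk, so that its           *)
(* cardinality is the length of that walk.                                    *)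
Definition faces : {set {set dart F}} := porbits next_dart.

Definition pentagons : {set {set dart F}} := [set f in faces | #|f| == 5].
Definition hexagons : {set {set dart F}} := [set f in faces | #|f| == 6].

Definition face_vertices (f : {set dart F}) : {set F} := [set dtail d | d in f].

Definition fullerene : Prop :=
  [/\ k_connected F 3, cubic F, #|pentagons| = 12
    & forall f, f \in faces -> f \notin pentagons -> f \in hexagons].

Definition disjoint_hexagons (H : {set {set dart F}}) : Prop :=
  H \subset hexagons /\
  {in H &, forall f g, f != g -> [disjoint face_vertices f & face_vertices g]}.

Definition alternating (M : {set {set F}}) (f : {set dart F}) : Prop :=
  forall d, d \in f -> (edge_of d \in M) = (edge_of (next_dart d) \notin M).

Definition resonant_pattern (H : {set {set dart F}}) : Prop :=
  disjoint_hexagons H /\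
  exists2 M : {set {set F}},
    perfect_matching M & forall f, f \in H -> alternating M f.

Definition k_resonant (k : nat) : Prop :=
  forall i, i <= k ->
  forall H : {set {set dart F}},
    disjoint_hexagons H -> #|H| = i -> resonant_pattern H.

End Fullerene.

(* Main.v *)
(* 3-resonance leaves only finitely many fullerene graphs. If the three          *)
(* neighbours of a vertex lie on three disjoint hexagons that avoid the vertex,   *)
(* these are not resonant; so nearly every vertex is joined to a pentagon by an   *)
(* edge leaving the pentagon, and there are at most 12 * 5 such edges. The        *)
(* remaining graphs are found by exploring [F], edge after edge, from a vertex of *)
(* a pentagon. The next edge leads to a new vertex or to a vertex already seen on *)
(* the boundary of the same unexplored region: this is the Jordan curve theorem,  *)
(* which follows from Euler's formula. A partial map is abandoned when a face     *)
(* cannot have length 5 or 6, when an edge is doubled, or when at most three      *)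
(* disjoint hexagons fail to be resonant. In every complete map that is reached,  *)
(* either some three disjoint hexagons are not resonant or any four or more       *)
(* disjoint hexagons are alternating in a perfect matching found on the spot.     *)

(* Only the direction from 3-resonance to k-resonance has content, and only for sets of at least
   four hexagons. It is settled by a computation whose soundness is proved here: an arbitrary
   3-resonant fullerene graph [F] is followed through the search.

   The invariant [valid] says that the current partial map sits in [F] by a map [f] on darts, with
   the root on a pentagon, and that the regions list every unmatched dart. In [searchP] the chosen
   dart [x] is read off in [F]. If the reverse of [f x] is already in the image of [f], then by
   [jordan] and [mate_in_region] it comes from an unmatched dart of the same region, and
   [valid_link] applies; otherwise the edge leads to a new vertex and [valid_new] applies. So one
   branch of the search always follows [F].

   No test prunes that branch. The length tests hold because faces have length 5 or 6 ([valid_seg],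
   [closing_fits]), [joinable] because [F] is simple ([joinableP]), and [bad_face] would exhibit at
   most three disjoint hexagons that are not resonant, or a hexagon in place of the root pentagon
   ([bad_faceP], resting on [chain_fromP]). The branch therefore ends in a complete map, which is
   all of [F] by connectedness ([map_onto]). There [leafP] either contradicts 3-resonance or gives
   the perfect matchings that are wanted.

   Termination is not proved in general: [search] answers [false] when its fuel runs out, so the
   evaluation in [run_leaf] certifies at once that the exploration is finite and that every complete
   map passes. *)
From HB Require Import structures.
From Stdlib Require Import PArith FMapPositive.
Require Import Defs.
From mathcomp Require Import all_boot all_fingroup.
From mathcomp Require Import zify.

Set Implicit Arguments.
Unset Strict Implicit.
Unset Printing Implicit Defensive.

(** * The Jordan property of plane maps *)

Section Jordan.
Variables (T : finType) (e : T -> T) (r : {perm T}).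
Hypothesis eK : involutive e.
Hypothesis e_neq : forall x, e x != x.
Implicit Types (A B : {set T}) (x y : T).

(** Here [e] reverses darts, [r] is the rotation and [A] is an edge set given by its darts. A dart
    outside [A] is fixed: it is a dangling half-edge around which the boundary walk [face_on] turns.
    All the maps obtained as [A] grows thus share their darts and vertices. *)
Definition rev_on A x := if (x \in A) && (e x \in A) then e x else x.

Lemma rev_onK A : involutive (rev_on A).
Proof.
move=> x; rewrite /rev_on; case hx: ((x \in A) && (e x \in A)); last by rewrite hx.
by case/andP: hx => xA exA; rewrite exA eK xA.
Qed.

Definition rev_perm A : {perm T} := perm (inv_inj (rev_onK A)).
Definition face_on A : {perm T} := (rev_perm A * r)%g.
Definition near A : rel T := [rel x y | [|| y == r x, x == r y | y == rev_on A x]].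
Definition comp_on A x : {set T} := [set y | connect (near A) x y].
Definition comps_on A : {set {set T}} := [set comp_on A x | x in T].
Definition closed_set A := {in A, forall x, e x \in A}.

Lemma rev_permE A x : rev_perm A x = rev_on A x. Proof. by rewrite permE. Qed.
Lemma face_onE A x : face_on A x = r (rev_on A x). Proof. by rewrite permM rev_permE. Qed.

Lemma near_sym A : symmetric (near A).
Proof.
move=> x y; rewrite /near /= orbA orbA (orbC (y == _)); congr (_ || _).
by apply/eqP/eqP => ->; rewrite rev_onK.
Qed.

Lemma conn_sym A : connect_sym (near A).
Proof. exact/sym_connect_sym/near_sym. Qed.

Lemma comp_on_eq A x y : (comp_on A x == comp_on A y) = connect (near A) x y.
Proof.
apply/eqP/idP => [/setP/(_ y)|xy]; first by rewrite !inE connect0.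
by apply/setP => z; rewrite !inE; apply: same_connect; first exact: conn_sym.
Qed.

Lemma conn_rot A x : connect (near A) x (r x).
Proof. by apply: connect1; rewrite /near /= eqxx. Qed.

Lemma conn_rev_on A x : connect (near A) x (rev_on A x).
Proof. by apply: connect1; rewrite /near /= eqxx !orbT. Qed.

Lemma conn_face_on A x y : y \in porbit (face_on A) x -> connect (near A) x y.
Proof.
case/porbitP=> i ->; elim: i => [|i IH]; first by rewrite expg0 perm1.
rewrite expgSr permM face_onE; apply: connect_trans IH _.
by apply: connect_trans (conn_rot _ _); apply: conn_rev_on.
Qed.

Section AddEdge.
Variables (A : {set T}) (x : T).
Hypothesis Acl : closed_set A.
Hypothesis xA : x \notin A.
Let B := x |: (e x |: A).

Let cl y : (e y \in A) = (y \in A).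
Proof.
by apply/idP/idP => [/Acl|/Acl//]; rewrite eK.
Qed.

Lemma closed_add : closed_set B.
Proof.
move=> y; rewrite !inE => /or3P[/eqP->|/eqP->|yA].
- by rewrite eqxx orbT.
- by rewrite eK eqxx.
- by rewrite cl yA !orbT.
Qed.

Lemma rev_on_add y : rev_on B y = if y == x then e x else if y == e x then x else rev_on A
    y.
Proof.
rewrite /rev_on !inE cl andbb.
case: (eqVneq y x) => [->|ynx]; first by rewrite eqxx !orbT.
case: (eqVneq y (e x)) => [->|ynex] /=; first by rewrite eK eqxx.
by rewrite (inv_eq eK) (negPf ynex) (can_eq eK) (negPf ynx) /= andbb.
Qed.

Lemma rev_on_fix y : (y == x) || (y == e x) -> rev_on A y = y.
Proof.
by rewrite /rev_on cl andbb => /orP[]/eqP->; rewrite ?cl (negPf xA).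
Qed.

Lemma rev_perm_add : rev_perm B = (tperm x (e x) * rev_perm A)%g.
Proof.
apply/permP => y; rewrite permM !rev_permE rev_on_add.
case: tpermP => [->|->|/eqP/negPf-> /eqP/negPf->] //.
- by rewrite eqxx rev_on_fix // eqxx orbT.
- by rewrite (negPf (e_neq x)) eqxx rev_on_fix // eqxx.
Qed.

Lemma face_on_add : face_on B = (tperm x (e x) * face_on A)%g.
Proof. by rewrite /face_on rev_perm_add mulgA. Qed.

Lemma card_rev_perm_add : (#|porbits (rev_perm B)|.+1 = #|porbits (rev_perm A)|)%N.
Proof.
have := porbits_mul_tperm (rev_perm A) x (e x); rewrite /= -rev_perm_add.
have -> : x \notin porbit (rev_perm A) (e x).
  rewrite porbit_sym; apply/negP => /porbitP[i].
  have -> : (rev_perm A ^+ i)%g x = x.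
    by elim: i => [|i IH]; rewrite ?expg0 ?perm1 // expgSr permM IH rev_permE rev_on_fix
        ?eqxx.
  by move/eqP; rewrite (negPf (e_neq x)).
by rewrite eq_sym e_neq /= addn1 addn2 => -[].
Qed.

(** A path that crosses the new edge back and forth can be shortened, so one crossing is enough. *)
Lemma conn_add u v : connect (near B) u v =
  [|| connect (near A) u v, connect (near A) u x && connect (near A) (e x) v
    | connect (near A) u (e x) && connect (near A) x v].
Proof.
have sub a b : connect (near A) a b -> connect (near B) a b.
  apply: connect_sub => {}a {}b /or3P[/eqP->|/eqP->|/eqP->].
  - exact: conn_rot.
  - by rewrite conn_sym conn_rot.
  - case: (boolP ((a == x) || (a == e x))) => [h|]; first by rewrite rev_on_fix.
    rewrite negb_or => /andP[/negPf h1 /negPf h2]; apply: connect1.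
    by rewrite /near /= rev_on_add h1 h2 eqxx !orbT.
have ex : connect (near B) x (e x).
  by apply: connect1; rewrite /near /= rev_on_add eqxx eqxx !orbT.
apply/idP/or3P => [|[/sub//|/andP[/sub h1 /sub h2]|/andP[/sub h1 /sub h2]]]; last 2 first.
- exact: connect_trans (connect_trans h1 ex) h2.
- by apply: connect_trans (connect_trans h1 _) h2; rewrite conn_sym.
case/connectP=> p; elim/last_ind: p v => [|p w IH] v /=.
  by move=> _ ->; constructor; apply: connect0.
rewrite rcons_path last_rcons => /andP[/IH{IH}/(_ _ erefl) IH + ->] {v}.
set z := last u p in IH *; move=> zw.
have [zw'|] : connect (near A) z w \/ (z = x /\ w = e x) \/ (z = e x /\ w = x).
- case/or3P: zw => [/eqP->|/eqP->|/eqP->]; first by left; apply: conn_rot.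
    by left; rewrite conn_sym conn_rot.
  rewrite rev_on_add; case: eqP => [->|_]; first by right; left.
  by case: eqP => [->|_]; [right; right | left; apply: conn_rev_on].
- case: IH => [h|/andP[h1 h2]|/andP[h1 h2]].
  + by constructor 1; apply: connect_trans h zw'.
  + by constructor 2; rewrite h1 (connect_trans h2 zw').
  + by constructor 3; rewrite h1 (connect_trans h2 zw').
- case=> [][zx ->]; rewrite zx in IH; case: IH => [h|/andP[h1 h2]|/andP[h1 h2]].
  + by constructor 2; rewrite h connect0.
  + by constructor 2; rewrite h1 connect0.
  + by constructor 1.
  + by constructor 3; rewrite h connect0.
  + by constructor 1.
  + by constructor 3; rewrite h1 connect0.
Qed.

Lemma comps_on_add_same : connect (near A) x (e x) -> comps_on B = comps_on A.
Proof.
move=> h; apply: eq_imset => u; apply/setP => v; rewrite !inE conn_add.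
apply/or3P/idP => [[//|/andP[h1 h2]|/andP[h1 h2]]|->]; last by constructor.
- exact: connect_trans (connect_trans h1 h) h2.
- by apply: connect_trans (connect_trans h1 _) h2; rewrite conn_sym.
Qed.

(** Sending a component for [A] to the component for [B] that contains it is injective once the
    component of [e x] is left out. *)
Lemma comps_on_add : #|comps_on A| <= #|comps_on B|.+1.
Proof.
rewrite (cardsD1 (comp_on A (e x))) -add1n leq_add ?leq_b1 //.
pose h (K : {set T}) := \bigcup_(v in K) comp_on B v.
have hE u : h (comp_on A u) = comp_on B u.
  apply/setP => v; apply/bigcupP/idP => [[w]|uv]; last by exists u; rewrite // inE connect0.
  rewrite !inE => uw; apply: connect_trans; rewrite conn_add uw //.
rewrite -(card_in_imset (f := h)) => [|K L]; last first.
  rewrite !inE => /andP[Kne /imsetP[u _ defK]] /andP[Lne /imsetP[v _ defL]].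
  rewrite defK defL !hE => /eqP;
      rewrite comp_on_eq conn_add => /or3P[|/andP[_ h2]|/andP[h1 _]].
  - by move=> uv; apply/eqP; rewrite comp_on_eq.
  - by case/negP: Lne; rewrite defL eq_sym comp_on_eq.
  - by case/negP: Kne; rewrite defK comp_on_eq.
apply: subset_leq_card; apply/subsetP => _ /imsetP[K + ->].
by rewrite !inE => /andP[_ /imsetP[u _ ->]]; rewrite hE imset_f.
Qed.

(* [euler_rhs C - euler_lhs C] is twice the total genus of the map with edge set [C]. *)
Definition euler_lhs C := #|porbits (rev_perm C)| + #|porbits r| + #|porbits (face_on C)|.
Definition euler_rhs C := #|T| + #|comps_on C|.*2.

(** The new edge lowers the number of edge orbits by one. If its two darts lie on one face cycle,
    that cycle splits and the sum is unchanged. If they lie on two, these merge and the left side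
    drops by 2; this is compensated on the right only when two components merge as well. In the
    remaining case, marked by [b], the genus grows by one. *)
Lemma euler_add k (b := connect (near A) x (e x) && (x \notin porbit (face_on A) (e x))) :
  euler_lhs A + k <= euler_rhs A -> euler_lhs B + k + b.*2 <= euler_rhs B.
Proof.
rewrite {}/b /euler_lhs /euler_rhs; have := card_rev_perm_add.
have := porbits_mul_tperm (face_on A) x (e x); rewrite /= -face_on_add [x == _]eq_sym e_neq.
have := comps_on_add; have := comps_on_add_same.
case: (boolP (connect _ _ _)) => [_ /(_ isT)-> _|nc _].
  by case: (x \notin _) => /=; lia.
have -> /= : x \notin porbit (face_on A) (e x).
  by apply: contra nc => /conn_face_on; rewrite conn_sym.
lia.
Qed.
End AddEdge.

Lemma euler_mono A B k : closed_set A -> closed_set B -> A \subset B ->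
  euler_lhs A + k <= euler_rhs A -> euler_lhs B + k <= euler_rhs B.
Proof.
move=> + Bcl; have [n] := ubnP #|B :\: A|; elim: n A => // n IH A ltn Acl sAB le.
case: (set_0Vmem (B :\: A)) => [/eqP|[x xBA]].
  by rewrite setD_eq0 => sBA; rewrite (_ : B = A) //; apply/eqP; rewrite eqEsubset sBA.
case/setDP: (xBA) => xB xA; apply: (IH (x |: (e x |: A))).
- rewrite -ltnS; apply: leq_trans ltn; rewrite ltnS; apply: proper_card.
  rewrite properE; apply/andP; split.
    by apply: setDS; rewrite setUA subsetUr.
  by apply/subsetPn; exists x => //; rewrite !inE eqxx.
- exact: closed_add.
- by rewrite !subUset !sub1set xB sAB Bcl.
- by apply: leq_trans (euler_add Acl xA le); rewrite leq_addr.
Qed.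

(** Without edges each vertex is a component with a single face cycle, namely its rotation orbit, so
    the genus is 0. *)
Lemma euler_set0 : euler_lhs set0 <= euler_rhs set0.
Proof.
rewrite /euler_lhs /euler_rhs.
have a1 : rev_perm set0 = 1%g by apply/permP => x; rewrite rev_permE perm1 /rev_on inE.
rewrite /face_on a1 mul1g.
have -> : porbits 1 = [set [set x] | x in T].
  apply: eq_imset => x; apply/setP => y; rewrite inE; apply/porbitP/eqP => [[i]|->].
    by rewrite expg1n perm1.
  by exists 0; rewrite expg0 perm1.
rewrite card_imset ?cardsT; last exact: set1_inj.
have rp z : r z \in porbit r z by have := mem_porbit r 1 z; rewrite expg1.
have conn0 x y : connect (near set0) x y = (y \in porbit r x).
  apply/idP/idP => [|h]; last by apply: conn_face_on; rewrite /face_on a1 mul1g.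
  case/connectP=> p; elim/last_ind: p y => [|p z IH] y /=; first by move=> _ ->;
      apply: porbit_id.
  rewrite rcons_path last_rcons => /andP[/IH/(_ erefl){}IH + ->] {y}.
  have /eqP->: porbit r x == porbit r (last x p) by rewrite eq_porbit_mem porbit_sym.
  case/or3P=> /eqP; last by rewrite /rev_on inE => ->; apply: porbit_id.
    by move->; apply: rp.
  by move=> E; rewrite porbit_sym {1}E; apply: rp.
have -> : comps_on set0 = porbits r by apply: eq_imset => x; apply/setP => y;
    rewrite inE conn0.
by rewrite -addnA addnn.
Qed.

(* Adding the edges one at a time, each either joins two components or splits a
   face cycle; joining two face cycles of one component would lower the Euler
   characteristic for good. *)
Lemma jordan A x : closed_set A -> x \notin A ->
  euler_rhs setT <= euler_lhs setT ->
  connect (near A) x (e x) -> e x \in porbit (face_on A) x.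
Proof.
move=> Acl xA le xex; apply/negPn/negP => nin.
have A0 : euler_lhs A + 0 <= euler_rhs A.
  apply: (@euler_mono set0); rewrite ?sub0set ?addn0 ?euler_set0 // => y; rewrite inE.
  by [].
have := euler_add Acl xA A0; rewrite xex porbit_sym nin /= addn0.
set B := x |: _ => /(@euler_mono B setT 2).
have Bcl : closed_set B by apply: closed_add.
move/(_ Bcl (fun _ _ => in_setT _) (subsetT _)); lia.
Qed.
End Jordan.

(** * Darts of a fullerene graph *)

Lemma card_const_fibers_in (T X : finType) (f : T -> X) (A : {set T}) k :
  {in A, forall x, #|[set y in A | f y == f x]| = k} -> #|A| = #|f @: A| * k.
Proof.
move=> fib; rewrite -[LHS]sum1_card (partition_big f (fun y => y \in f @: A)) /=;
    last first.
  by move=> x; apply: imset_f.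
rewrite -sum_nat_const; apply: eq_bigr => _ /imsetP[x xA ->].
by rewrite sum1_card -(fib x xA); apply: eq_card => y; rewrite !inE.
Qed.

Lemma card_const_fibers (T X : finType) (f : T -> X) k :
  (forall x, #|[pred y | f y == f x]| = k) -> #|T| = #|[set f x | x in T]| * k.
Proof.
move=> fib; rewrite -cardsT (card_const_fibers_in (f := f) (k := k)) => [|x _]; last first.
  by rewrite -(fib x); apply: eq_card => y; rewrite !inE.
by congr (_ * _); apply: eq_card => y; apply/imsetP/imsetP => -[x _ ->]; exists x.
Qed.

Lemma card_const_porbits (T : finType) (s : {perm T}) k :
  (forall x, #|porbit s x| = k) -> #|T| = #|porbits s| * k.
Proof.
move=> h; apply: card_const_fibers => x; rewrite -(h x); apply: eq_card => y.
by rewrite inE eq_porbit_mem.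
Qed.

Section FullereneDarts.
Variables (F : plane_graph).
Hypothesis HF : fullerene F.
Implicit Types d : dart F.
Local Notation r := (rotation F).
Local Notation e := (@drev F).

Lemma next_dartE d : next_dart F d = r (e d).
Proof. by rewrite permM permE. Qed.

Lemma dhead_drev d : dhead (e d) = dtail d. Proof. by []. Qed.
Lemma dtail_drev d : dtail (e d) = dhead d. Proof. by []. Qed.

Lemma dart_eq d d' : dtail d = dtail d' -> dhead d = dhead d' -> d = d'.
Proof.
move=> t h; apply: val_inj.
by rewrite (surjective_pairing (val d)) (surjective_pairing (val d')); congr (_, _).
Qed.

Lemma dtail_neq d : dtail d != dhead d.
Proof.
by apply/eqP => t; have := valP d; rewrite -/(dtail d) -/(dhead d) t adj_irr.
Qed.

Lemma drev_neq d : e d != d.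
Proof. by apply/eqP => /(congr1 (@dtail F)) /eqP;
    rewrite dtail_drev eq_sym (negPf (dtail_neq d)). Qed.

Lemma porbit_rotation d : porbit r d = [set d' | dtail d' == dtail d].
Proof.
apply/setP => d'; rewrite inE; apply/porbitP/eqP => [[i ->]|E].
  by elim: i => [|i IH]; rewrite ?expg0 ?perm1 // expgSr permM dtail_rotation.
by apply/porbitP; apply: rotation_cyclic.
Qed.

Lemma adj_dart (x y : F) : adj x y -> exists2 d : dart F, dtail d = x & dhead d = y.
Proof. by move=> xy; exists (Sub (x, y) xy). Qed.

Lemma card_porbit_rotation d : #|porbit r d| = 3.
Proof.
have [_ /(_ (dtail d)) <- _ _] := HF; rewrite porbit_rotation.
rewrite -(card_in_imset (f := @dhead F)) => [|d1 d2]; last first.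
  by rewrite !inE => /eqP E1 /eqP E2; apply: dart_eq; rewrite E1.
congr #|pred_of_set _|; apply/setP => y; rewrite inE; apply/imsetP/idP => [[d']|].
  by rewrite inE => /eqP <- ->; exact: (valP d').
by case/adj_dart => d' E <-; exists d'; rewrite // inE E.
Qed.

Lemma rotation3 d : r (r (r d)) = d.
Proof. by rewrite -[RHS](iter_porbit r) card_porbit_rotation. Qed.

Lemma rotation_uniq d : uniq [:: d; r d; r (r d)].
Proof. by have := uniq_traject_porbit r d; rewrite card_porbit_rotation. Qed.

Lemma rot_cases d d' : dtail d' = dtail d -> [\/ d' = d, d' = r d | d' = r (r d)].
Proof.
move=> E; have : d' \in porbit r d by rewrite porbit_rotation inE E.
rewrite porbit_traject card_porbit_rotation !inE => /or3P[]/eqP;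
    by [constructor 1|constructor 2|constructor 3].
Qed.

Lemma card_face d : #|porbit (next_dart F) d| = 5 \/ #|porbit (next_dart F) d| = 6.
Proof.
have [_ _ _ /(_ (porbit (next_dart F) d))] := HF.
have f : porbit (next_dart F) d \in faces F by apply: imset_f.
by rewrite !inE f /=; case: eqP => [|_ /(_ isT isT)/eqP]; [left|right].
Qed.

(** Connectedness of [F] expressed on darts: rotation and reversal generate a transitive action. *)
Lemma dart_ind (P : dart F -> Prop) d0 : P d0 -> (forall d, P d -> P (r d)) ->
  (forall d, P d -> P (e d)) -> forall d, P d.
Proof.
move=> P0 Pr Pe.
have Pt d d' : P d -> dtail d' = dtail d -> P d'.
  by move=> Pd /rot_cases[] ->; [|apply: Pr|apply/Pr/Pr].
move=> d; have := @pg_connected F (dtail d0) (dtail d);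
    rewrite !inE => /(_ isT isT)/connectP[p].
elim/last_ind: p d => [|p y IH] d; first by move=> _ /= E; apply: Pt P0 _.
rewrite rcons_path last_rcons => /andP[pp /and3P[_ _ ay]] E.
have [d1 t1 h1] := adj_dart ay.
by apply: (Pt (e d1)); rewrite ?E //; apply/Pe/(IH _ pp).
Qed.

Lemma edge_of_drev d : edge_of (e d) = edge_of d.
Proof. by rewrite /edge_of setUC. Qed.

Lemma edge_of_eq d d' : edge_of d = edge_of d' -> d' = d \/ d' = e d.
Proof.
move=> /setP E; have /orP[] : (dtail d' == dtail d) || (dtail d' == dhead d).
- by have := E (dtail d'); rewrite /edge_of !inE eqxx /= => ->.
- move=> /eqP t; left; apply: dart_eq => //; have := E (dhead d');
    rewrite /edge_of !inE eqxx orbT.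
  by rewrite -t eq_sym (negPf (dtail_neq d')) => /eqP.
move=> /eqP t; right; apply: dart_eq => //; have := E (dhead d');
    rewrite /edge_of !inE eqxx orbT.
by rewrite -t orbC eq_sym (negPf (dtail_neq d')) => /eqP.
Qed.

Lemma edgesE : edges F = [set edge_of d | d : dart F].
Proof.
apply/setP => E; apply/imsetP/imsetP => [[[x y] xy ->]|[d _ ->]].
  by rewrite inE in xy; have [d t h] := adj_dart xy; exists d; rewrite // /edge_of t h.
by exists (val d); rewrite // inE; apply: (valP d).
Qed.

Lemma card_edges : #|{: dart F}| = #|edges F| * 2.
Proof.
rewrite edgesE; apply: card_const_fibers => d.
rewrite (eq_card (B := [set d; e d])) ?cards2 1?eq_sym ?drev_neq //.
move=> d'; rewrite !inE.
by apply/eqP/orP => [/esym/edge_of_eq[]->|[]/eqP->]; rewrite ?eqxx ?edge_of_drev; auto.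
Qed.

Lemma card_vertices : #|{: dart F}| = #|F| * 3.
Proof.
have -> : #|F| = #|[set dtail d | d : dart F]|.
  rewrite -cardsT; apply: eq_card => x; rewrite inE; apply/esym/imsetP.
  have [_ /(_ x) c _ _] := HF; have /card_gt0P[y] : 0 < #|[set y | adj x y]| by rewrite c.
  by rewrite inE => /adj_dart[d <- _]; exists d.
apply: card_const_fibers => d; rewrite -(card_porbit_rotation d) porbit_rotation.
by apply: eq_card => d'; rewrite !inE.
Qed.

(** With all edges present there is one component and there are twice as many darts as edges, so
    this is Euler's formula with the number of edges added to both sides. *)
Lemma euler_dart : euler_rhs e r setT <= euler_lhs r (@drevK F) setT.
Proof.
rewrite /euler_rhs /euler_lhs.
have partT d : rev_on e setT d = e d by rewrite /rev_on !inE.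
have -> : comps_on e r setT = [set setT].
  apply/setP => C; rewrite inE; apply/imsetP/eqP => [[d _ ->]|->].
    apply/setP => d'; rewrite !inE; move: d'.
    apply: (@dart_ind (connect (near e r setT) d) d) => [|d' h|d' h]; first exact: connect0.
      by apply: connect_trans h (conn_rot _ _ _ _).
    by apply: connect_trans h _; rewrite -[X in connect _ _ X]partT; apply: conn_rev_on.
  have [d] : exists d : dart F, d \in setT.
    have [_ _ p _] := HF; have /card_gt0P[f] : 0 < #|pentagons F| by rewrite p.
    by rewrite !inE => /andP[/imsetP[d _ _] _]; exists d; rewrite inE.
  move=> _; exists d => //; apply/esym/setP => d'; rewrite !inE; move: d'.
  apply: (@dart_ind (connect (near e r setT) d) d) => [|d' h|d' h]; first exact: connect0.
    by apply: connect_trans h (conn_rot _ _ _ _).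
  by apply: connect_trans h _; rewrite -[X in connect _ _ X]partT; apply: conn_rev_on.
have -> : face_on r (@drevK F) setT = next_dart F.
  by apply/permP => d; rewrite face_onE next_dartE partT.
have -> : #|porbits (rev_perm (@drevK F) setT)| = #|edges F|.
  have E d : porbit (rev_perm (@drevK F) setT) d = [set d; e d].
    apply/setP => d'; rewrite !inE; apply/porbitP/orP => [[i ->]|[]/eqP->].
    - elim: i => [|i [/eqP IH|/eqP IH]]; first by rewrite expg0 perm1 eqxx; left.
        by right; rewrite expgSr permM IH rev_permE partT.
      by left; rewrite expgSr permM IH rev_permE partT drevK.
    - by exists 0; rewrite expg0 perm1.
    - by exists 1; rewrite expg1 rev_permE partT.
  have := card_const_porbits (fun d => _ : #|porbit (rev_perm (@drevK F) setT) d| = 2).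
  rewrite card_edges => h; apply/eqP; rewrite -(eqn_pmul2r (m := 2)) // -h // => d.
  by rewrite E cards2 eq_sym drev_neq.
have -> : #|porbits r| = #|F|.
  apply/eqP; rewrite -(eqn_pmul2r (m := 3)) // -card_vertices.
  by rewrite -(card_const_porbits card_porbit_rotation).
have := @pg_euler F; rewrite -/(faces F) cards1 card_edges /faces; lia.
Qed.
End FullereneDarts.

(** * Partial maps and the search *)

Lemma pos_eqP : Equality.axiom Pos.eqb.
Proof. by move=> x y; apply: (iffP idP) => /Pos.eqb_eq. Qed.
HB.instance Definition _ := hasDecEq.Build positive pos_eqP.

(* In a partial map a dart is a positive number: the two low bits (00, 01 or 10) *)
(* give its place in the rotation at the vertex coded by the remaining bits. An  *)
(* unmatched dart is one whose edge has not been explored yet.                   *)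
Definition mates := PositiveMap.t positive.
Definition mate (m : mates) (d : positive) := PositiveMap.find d m.
Arguments mate : simpl never.
Definition link x y (m : mates) : mates :=
  PositiveMap.add x y (PositiveMap.add y x m).

Definition vert (p : positive) : positive :=
  match p with
  | xO (xO v) | xI (xO v) | xO (xI v) | xI (xI v) => v
  | _ => xH
  end.
Definition rotp (p : positive) : positive :=
  match p with
  | xO (xO v) => xI (xO v)
  | xI (xO v) => xO (xI v)
  | xO (xI v) => xO (xO v)
  | _ => p
  end.
Definition dart0 v : positive := xO (xO v).
Definition dart1 v : positive := xI (xO v).
Definition dart2 v : positive := xO (xI v).
Definition orbit3 d := [:: d; rotp d; rotp (rotp d)].
Definition darts (vs : seq positive) := flatten [seq orbit3 (dart0 v) | v <- vs].

Fixpoint walk (m : mates) n c : option positive :=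
  if n is n'.+1 then if mate m c is Some d then walk m n' (rotp d) else None
  else Some c.

Fixpoint face_walk (n : nat) (m : mates) (x c : positive) : option (seq positive) :=
  if mate m c is Some d then
    if rotp d == x then Some [:: c]
    else if n is n'.+1 then
      if face_walk n' m x (rotp d) is Some l then Some (c :: l) else None
    else None
  else None.
(** Fuel 5 allows six darts, the greatest length of a face. *)
Definition face m x := face_walk 5 m x x.
Definition hexagon_at m x :=
  if face m x is Some l then if size l == 6 then Some l else None else None.

Definition apart (h u : seq positive) := ~~ has (mem u) h.

(* [block m H d] makes the head of [d] a vertex of the set [H] of disjoint       *)
(* hexagons (given by their vertices), adding to [H] the face that meets the     *)
(* head but not the edge of [d] if necessary.                                    *)
Definition block m (H : seq (seq positive)) d :=
  if mate m d is Some e then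
    if vert e \in flatten H then Some H
    else if size H < 3 then
      if hexagon_at m (rotp (rotp e)) is Some l then
        let h := map vert l in
        if all (apart h) H then Some (h :: H) else None
      else None
    else None
  else None.
Definition blocks m H d d' :=
  if block m H d is Some H' then block m H' d' else None.

Definition onward m d :=
  if mate m d is Some e then pmap (mate m) [:: rotp e; rotp (rotp e)] else [::].
Definition avoids (T : seq positive) (H : seq (seq positive)) := apart T (flatten H).

(* If the hexagons of [H] are alternating and the other two neighbours of the    *)
(* tail of [d] are blocked, then [d] is matched; if one is blocked and the edge  *)
(* of the other ends where an edge already forced ends, then again [d] is        *)
(* matched. [chain] follows such alternating paths, of tails [T].                *)
Fixpoint chain n m H T d : bool :=
  let a := rotp d in
  let b := rotp a in
  let T' := vert d :: T in
  (if blocks m H a b is Some H' then avoids T' H' else false) ||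
  (if n is n'.+1 then
     (if block m H a is Some H' then has (chain n' m H' T') (onward m b) else false) ||
     (if block m H b is Some H' then has (chain n' m H' T') (onward m a) else false)
   else false).
(* No edge is left for the tail of [d]: at most three disjoint hexagons are then *)
(* not resonant.                                                                 *)
Definition chain_from n m d :=
  if blocks m [::] (rotp d) (rotp (rotp d)) is Some H then
    (if block m H d is Some H' then avoids [:: vert d] H' else false) ||
    has (chain n m H [:: vert d]) (onward m d)
  else false.

(* Tested on the dart [x] of a face that has just been closed. *)
Definition bad_face (root : positive) m x :=
  if hexagon_at m x is Some l then
    (if face m root is Some l' then size l' == 6 else false) ||
    has (fun y => if mate m (rotp y) is Some d then has (chain_from 1 m) (orbit3 d)
                  else false) l
  else false.

(* A region is a face of the partial map, given by the cyclic list of its        *)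
(* unmatched darts [x], each with the number of edges of the boundary walk that  *)
(* separate it from the previous one.                                            *)
Definition region := seq (nat * positive).
Definition lengthen k (r : region) : region :=
  if r is (s, y) :: r' then (k + s, y) :: r' else [::].
(** A new edge merges two stretches of the boundary into one of [s + 1 + t] edges. The face of such
    a stretch also contains the edge of the unmatched dart at its end, hence the bound 5. When no
    unmatched dart is left, the face closes with [s + 1] edges, which must be at least 5. *)
Definition fits s (r : region) := if r is (t, _) :: _ then s + 1 + t <= 5 else 4 <= s.
Definition add_region (r : region) rs : seq region := if r is [::] then rs else r :: rs.

Fixpoint splits (p q : region) : seq (region * (nat * positive) * region) :=
  if q is y :: q' then (p, y, q') :: splits (rcons p y) q' else [::].

Definition joinable m x y :=
  (vert x != vert y) &&
  all (fun z => if mate m z is Some d then vert d != vert y else true) (orbit3 x).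

(* [best_dart] and [best_region] choose the place where the search goes on; they *)
(* affect its length, not its correctness.                                       *)
Definition dart_lt (a b : nat * positive) :=
  (b.1 < a.1) || (a.1 == b.1) && Pos.ltb a.2 b.2.
Fixpoint best_dart (p q : region) (a : nat * positive) (r : region) :=
  if q is b :: q' then
    if dart_lt b a then best_dart (rcons p b) q' b (q' ++ p)
    else best_dart (rcons p b) q' a r
  else (a, r).
Definition lowest (r : region) :=
  foldr (fun a d => if Pos.ltb a.2 d then a.2 else d) (head (0, 1%positive) r).2 r.
Definition region_lt (r r' : region) :=
  (size r < size r') || (size r == size r') && Pos.ltb (lowest r) (lowest r').
Fixpoint best_region (r : region) (done rs : seq region) :=
  if rs is r' :: rs' then
    if region_lt r' r then best_region r' (r :: done) rs'
    else best_region r (r' :: done) rs'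
  else (r, done).

Section Search.
Variables (root : positive) (leaf : mates -> seq positive -> bool).

(* The edge of the chosen dart [x] leads either to another unmatched dart [y] of *)
(* the same region, which it splits in two, or to a new vertex [nx].             *)
Fixpoint search (n : nat) (m : mates) (nx : positive) (vs : seq positive)
    (rs : seq region) : bool :=
  if n is n'.+1 then
    if rs is r0 :: rs0 then
      let (r, rest) := best_region r0 [::] rs0 in
      if r is a :: r' then
        let: ((s, x), ys) := best_dart [:: a] r' a r' in
        all (fun z => let: (r1, (t, y), r2) := z in
               if [&& joinable m x y, fits t r1 & fits s r2] then
                 let m' := link x y m in
                 if (nilp r1 && bad_face root m' y) || (nilp r2 && bad_face root m' x)
                 then true
                 else search n' m' nx vs (add_region (lengthen (t + 1) r1)
                                         (add_region (lengthen (s + 1) r2) rest))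
               else true) (splits [::] ys)
        &&
        let m' := link x (dart0 nx) m in
        let next r := search n' m' (Pos.succ nx) (nx :: vs) (r :: rest) in
        (* The edge to the new vertex lengthens the stretches before and after [x] by one each. If
           [x] is the only unmatched dart of the region, both are the same stretch, which grows by
           two. No stretch may exceed 5. *)
        if ys is (t, _) :: _ then
          if (s < 5) && (t < 5) then
            next ((s + 1, dart1 nx) :: (0, dart2 nx) :: lengthen 1 ys)
          else true
        else if s < 4 then next [:: (s + 2, dart1 nx); (0, dart2 nx)] else true
      else false
    else leaf m vs
  else false.
End Search.

(** * Tests on complete maps: certified matchings and odd components *)

Fixpoint remove_first (x : positive) (s : seq positive) : option (seq positive) :=
  if s is y :: s' then
    if x == y then Some s'
    else if remove_first x s' is Some t then Some (y :: t) else None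
  else None.
Fixpoint first_some (T S : Type) (f : T -> option S) (s : seq T) : option S :=
  if s is x :: s' then if f x is Some y then Some y else first_some f s' else None.

Definition in_hexagon m d := if hexagon_at m d is Some _ then true else false.
Definition ranked m v :=
  let l := orbit3 (dart0 v) in
  let p d := in_hexagon m d && (if mate m d is Some e then in_hexagon m e else false) in
  filter p l ++ filter (predC p) l.

(* Matchings are lists of darts. Nothing is proved about [matching]: what it     *)
(* finds is verified by [certified]. Trying first the edges between two hexagons *)
(* yields at once, for C60, a matching alternating on all the hexagons.          *)
Fixpoint matching n (m : mates) (av : seq positive) : option (seq positive) :=
  if av is v :: av' then
    if n is n'.+1 then
      first_some (fun d =>
        if mate m d is Some e then
          if remove_first (vert e) av' is Some t then
            if matching n' m t is Some M then Some (d :: M) else None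
          else None
        else None) (ranked m v)
    else None
  else Some [::].
Arguments matching : simpl never.

(** Each hexagon is listed once, starting from its least dart. *)
Definition hexagons_of m vs : seq (seq positive) :=
  pmap (fun d => if hexagon_at m d is Some l then
                   if all (Pos.leb d) l then Some l else None
                 else None) (darts vs).

Definition uncovered (vs : seq positive) (H : seq (seq positive)) :=
  let u := map vert (flatten H) in filter (fun v => v \notin u) vs.
Definition evens (l : seq positive) :=
  if l is [:: a; _; b; _; c; _] then [:: a; b; c] else [::].
Definition in_matching m (M : seq positive) d :=
  (d \in M) || (if mate m d is Some e then e \in M else false).
Definition alternates m (M : seq positive) (l : seq positive) :=
  let b := map (in_matching m M) l in
  (b == [:: true; false; true; false; true; false]) ||
  (b == [:: false; true; false; true; false; true]).
Definition ends m d := if mate m d is Some e then [:: vert d; vert e] else [::].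
Definition perfect m (vs M : seq positive) :=
  let u := flatten (map (ends m) M) in
  [&& all (fun d => mate m d != None) M, uniq u & all (fun v => v \in u) vs].
Definition certified m vs L M :=
  if all (alternates m M) L then perfect m vs M else false.
Definition disjoint_from (l l' : seq positive) := apart (map vert l) (map vert l').

(* Does every set of at least four disjoint hexagons that contains [H] and is    *)
(* contained in [H ++ L] have an alternating perfect matching?                   *)
Fixpoint resonant n m vs H L : bool :=
  if n is n'.+1 then
    if size H + size L < 4 then true
    else if (if matching 100 m (uncovered vs H) is Some M then
               certified m vs (H ++ L) (flatten (map evens H) ++ M)
             else false) then true
    else if L is h :: L' then
      if resonant n' m vs (h :: H) (filter (disjoint_from h) L')
      then resonant n' m vs H L' else false
    else false
  else false.

Fixpoint component n m (u s c : seq positive) : seq positive :=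
  if n is n'.+1 then
    if s is v :: s' then
      if (if v \in u then true else v \in c) then component n' m u s' c
      else component n' m u
             (pmap (fun d => omap vert (mate m d)) (orbit3 (dart0 v)) ++ s') (v :: c)
    else c
  else [::].
(** The easy half of Tutte's condition. As with [matching], nothing is proved about [component]: its
    output is checked to be an odd set of distinct vertices that avoids the hexagons of [H] and
    whose neighbours all lie in it or on these hexagons. *)
Definition odd_component m vs H :=
  if uncovered vs H is v :: _ then
    let u := map vert (flatten H) in
    let c := component 300 m u [:: v] [::] in
    [&& odd (size c), uniq c, all (fun v => v \notin u) c &
      all (fun d => if mate m d is Some e then (vert e \in c) || (vert e \in u)
                    else false) (darts c)]
  else false.
(** Looks for disjoint hexagons whose removal leaves an odd component; after the hexagon under
    consideration, [k] more are to be chosen. The call with [k = 2] and [H] empty therefore tests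
    triples. *)
Fixpoint belt n m vs k H L : bool :=
  if n is n'.+1 then
    if L is h :: L' then
      let H' := h :: H in
      if (if k is k'.+1 then belt n' m vs k' H' (filter (disjoint_from h) L')
          else odd_component m vs H') then true
      else belt n' m vs k H L'
    else false
  else false.

Definition leaf m vs :=
  let L := hexagons_of m vs in
  if has (chain_from 2 m) (darts vs) then true
  else if belt 30 m vs 2 [::] L then true
  else resonant 30 m vs [::] L.

Definition init_regions : seq region :=
  [:: [:: (0, dart0 1); (0, dart1 1); (0, dart2 1)]].

(** * Partial maps embedded in a fullerene graph *)

Lemma mate_link x y m d :
  mate (link x y m) d = if d == x then Some y else if d == y then Some x else mate m d.
Proof.
rewrite /mate /link; case: eqVneq => [->|dx]; first by rewrite PositiveMap.gss.
rewrite PositiveMap.gso; last exact/eqP.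
case: eqVneq => [->|dy]; first by rewrite PositiveMap.gss.
by rewrite PositiveMap.gso //; apply/eqP.
Qed.

Lemma orbit3_dart0 v : orbit3 (dart0 v) = [:: dart0 v; dart1 v; dart2 v]. Proof. by []. Qed.

Lemma mem_darts vs d : (d \in darts vs) = (vert d \in vs) && (d \in orbit3 (dart0 (vert
    d))).
Proof.
apply/flatten_mapP/andP => [[v vv]|[]]; last by exists (vert d).
by rewrite orbit3_dart0 !inE => /or3P[]/eqP->; rewrite /= vv !eqxx ?orbT.
Qed.

Lemma darts_rot vs d : d \in darts vs -> rotp d \in darts vs.
Proof.
by rewrite !mem_darts !inE => /andP[+ /or3P[]/eqP E]; rewrite E /= => ->;
    rewrite !eqxx ?orbT.
Qed.

Lemma vert_rotp d : vert (rotp d) = vert d.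
Proof. by case: d => [[]|[]|]. Qed.

Lemma darts_orbit3 vs d d' : d \in darts vs -> d' \in darts vs -> vert d' = vert d ->
    d' \in orbit3 d.
Proof.
rewrite !mem_darts !inE => /andP[_ hd] /andP[_ hd'] E; rewrite E in hd' *.
by case/or3P: hd => /eqP->; case/or3P: hd' => /eqP->; rewrite /= !eqxx ?orbT.
Qed.

Lemma walk_cat m n k c d : walk m n c = Some d -> walk m (n + k) c = walk m k d.
Proof.
elim: n c => [|n IH] c /=; first by case=> ->.
by case: (mate m c) => // c' /IH.
Qed.

Lemma walk_prefix m n k c d : walk m (n + k) c = Some d -> exists c', walk m n c = Some c'.
Proof.
elim: n c => [|n IH] c /=; first by exists c.
by case: (mate m c) => // c' /IH.
Qed.

Lemma walk_mono m m' n c d : (forall a b, mate m a = Some b -> mate m' a = Some b) ->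
  walk m n c = Some d -> walk m' n c = Some d.
Proof.
move=> mm; elim: n c => //= n IH c.
by case E: (mate m c) => [c'|//] /IH; rewrite (mm _ _ E).
Qed.

Section State.
Variables (F : plane_graph).
Hypothesis HF : fullerene F.
Local Notation r := (rotation F).
Local Notation e := (@drev F).
Local Notation phi := (next_dart F).

Record embedded (m : mates) (vs : seq positive) (f : positive -> dart F) : Prop :=
    Embedded {
  emb_inj : {in darts vs &, injective f};
  emb_rot : {in darts vs, forall d, f (rotp d) = r (f d)};
  emb_mate : forall d d', mate m d = Some d' ->
    [/\ d \in darts vs, mate m d' = Some d & f d' = e (f d)] }.

Section Embedded.
Variables (m : mates) (vs : seq positive) (f : positive -> dart F).
Hypothesis emb : embedded m vs f.

Lemma mate_dart d d' : mate m d = Some d' -> d' \in darts vs.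
Proof. by case/(emb_mate emb) => _ /(emb_mate emb)[]. Qed.

Lemma vert_dtail d d' : d \in darts vs -> d' \in darts vs ->
  (vert d == vert d') = (dtail (f d) == dtail (f d')).
Proof.
move=> dd dd'; apply/eqP/eqP => [E|E].
  have := darts_orbit3 dd' dd E; rewrite !inE.
  by case/or3P=> /eqP->; rewrite ?(emb_rot emb) ?darts_rot ?dtail_rotation.
have [] := rot_cases HF E; rewrite -?(emb_rot emb) ?darts_rot //.
- by move/(emb_inj emb) => ->.
- by move/(emb_inj emb) => ->; rewrite ?vert_rotp ?darts_rot.
- by move/(emb_inj emb) => ->; rewrite ?vert_rotp ?darts_rot.
Qed.

Lemma mate_next d d' : mate m d = Some d' -> f (rotp d') = phi (f d).
Proof.
by move=> dd'; rewrite next_dartE (emb_rot emb) ?(mate_dart dd') //;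
    case: (emb_mate emb dd') => _ _ ->.
Qed.

Lemma walk_iter n c d : walk m n c = Some d -> f d = iter n phi (f c).
Proof.
elim: n c => [|n IH] c /=; first by case=> <-.
by case E: (mate m c) => [c'|//] /IH->; rewrite (mate_next E) -iterSr.
Qed.

(** A return takes at least one full turn. With at most six steps, the only other possibility is six
    steps on a pentagon, and then [d] would be fixed by a single step. *)
Lemma short_cycle k d : iter k.+1 phi d = d -> k < 6 -> k.+1 = #|porbit phi d|.
Proof.
move=> kd lk; have kge : #|porbit phi d| <= k.+1.
  rewrite leqNgt; apply/negP => lt.
  have := uniq_traject_porbit phi d; rewrite -(subnK (ltnW lt)) addnC trajectD cat_uniq kd.
  case: (_ - _) (subn_gt0 k.+1 #|porbit phi d|) => [|i _]; first by rewrite lt.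
  by case/and3P=> _ /hasPn/(_ d); rewrite /= !inE eqxx => /(_ isT).
have [E|E] := card_face HF d; rewrite E in kge *; last by apply/eqP; rewrite eqn_leq lk kge.
apply/eqP; rewrite eqn_leq kge andbT leqNgt; apply/negP => k5.
have {}k5 : k = 5 by lia.
have := iter_porbit phi d; rewrite E => d5; move: kd; rewrite k5 iterS d5 => d1.
have := uniq_traject_porbit phi d; rewrite E /= d1; by rewrite !inE eqxx.
Qed.

Lemma face_walkP n x c l : face_walk n m x c = Some l ->
  [/\ size l <= n.+1, map f l = traject phi (f c) (size l), 0 < size l &
   iter (size l) phi (f c) = f x /\ {subset l <= darts vs}].
Proof.
elim: n c l => [|n IH] c l /=; case E: (mate m c) => [d|//]; case: eqP => // dx.
- case=> <-; split=> //=; split; first by rewrite -dx (mate_next E).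
  by move=> z; rewrite inE => /eqP->; case: (emb_mate emb E).
- case=> <-; split=> //=; split; first by rewrite -dx (mate_next E).
  by move=> z; rewrite inE => /eqP->; case: (emb_mate emb E).
case fw: (face_walk n m x (rotp d)) => [l'|//] [<-].
have [lel ml l0 [it sub]] := IH _ _ fw; split=> //=.
  by rewrite ml (mate_next E).
split; first by rewrite -iterS iterSr -(mate_next E).
by move=> z; rewrite inE => /predU1P[->|/sub//]; case: (emb_mate emb E).
Qed.

Lemma faceP x l : face m x = Some l ->
  [/\ map f l = traject phi (f x) (size l), size l = #|porbit phi (f x)| &
      {subset l <= darts vs}].
Proof.
case/face_walkP=> lel ml l0 [it sub]; split=> //.
by case: l lel ml l0 it sub => // d l lel _ _ it _; apply: short_cycle it _.
Qed.

Lemma hexagon_atP x l : hexagon_at m x = Some l ->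
  [/\ map f l = traject phi (f x) 6, porbit phi (f x) \in hexagons F,
      porbit phi (f x) =i map f l, size l = 6 & {subset l <= darts vs}].
Proof.
rewrite /hexagon_at; case fl: (face m x) => [l'|//]; case: eqP => // s6 [<-].
have [ml sl sub] := faceP fl; rewrite s6 in ml sl; split=> //.
  by rewrite inE -sl eqxx andbT; apply: imset_f.
by move=> d; rewrite porbit_traject -sl ml.
Qed.

(** In [F] the boundary walk from [r (f d)] comes to the reverse of [f d] in fewer than six steps. A
    walk of six matched darts would contain it, and its mate would be [d]. *)
Lemma no_long_walk d d' : d \in darts vs -> mate m d = None ->
    walk m 6 (rotp d) = Some d' -> False.
Proof.
move=> dd dN w6.
have mem k c : k < 6 -> walk m k (rotp d) = Some c -> mate m c <> None.
  move=> lk wk; move: w6; rewrite -(subnKC (ltnW lk)) (walk_cat _ wk).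
  by move: lk; rewrite -subn_gt0; case: (_ - k) => //= n _; case: (mate m c).
have [k lk kE] : exists2 k, k < 6 & iter k phi (r (f d)) = e (f d).
  have pr : phi (e (f d)) = r (f d) by rewrite next_dartE drevK.
  have : e (f d) \in porbit phi (r (f d)) by rewrite -pr porbit_sym -[phi _]/(iter 1 phi _)
      -permX mem_porbit.
  rewrite porbit_traject => /trajectP[k lk ->]; exists k => //.
  by apply: leq_trans lk _; case: (card_face HF (r (f d))) => ->.
have [c wc] : exists c, walk m k (rotp d) = Some c.
  by move: w6; rewrite -(subnKC (ltnW lk)) => /walk_prefix.
case mc: (mate m c) (mem k c lk wc) => [c'|//] _.
have fc : f c = e (f d) by rewrite (walk_iter wc) (emb_rot emb).
have [cd mc' fc'] := emb_mate emb mc; move: fc'; rewrite fc drevK => /(emb_inj emb).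
by move/(_ (mate_dart mc) dd) => E; move: mc'; rewrite E dN.
Qed.

End Embedded.

(** * The invariant of the search and its preservation *)

Definition linked m (a b : nat * positive) := walk m b.1 (rotp a.2) == Some b.2.
Definition pending (rs : seq region) := map snd (flatten rs).
Definition matched (m : mates) vs (f : positive -> dart F) :=
  [set z | has (fun d => (f d == z) && (mate m d != None)) (darts vs)].

(** [v_cycle] makes each region one cyclic boundary walk of the partial map, and [v_conn],
    connectedness through explored edges only, is what [jordan] requires. [v_open] makes a map
    without regions complete. *)
Record valid (root : positive) m nx vs rs f : Prop := Valid {
  v_emb : embedded m vs f;
  v_fresh : {in vs, forall v, (v < nx)%positive};
  v_open : {in darts vs, forall d, mate m d = None -> d \in pending rs};
  v_pend : {in pending rs, forall d, d \in darts vs /\ mate m d = None};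
  v_uniq : uniq (pending rs);
  v_cycle : forall q : region, q \in rs -> path.cycle (linked m) q;
  v_conn : {in darts vs, forall d, connect (near e r (matched m vs f)) (f root) (f d)};
  v_root : root \in darts vs;
  v_pent : #|porbit phi (f root)| = 5 }.

Lemma pending_cons q rs : pending (q :: rs) = map snd q ++ pending rs.
Proof. exact: map_cat. Qed.

Lemma linked_sub m m' : (forall a b, mate m a = Some b -> mate m' a = Some b) ->
    subrel (linked m) (linked m').
Proof. by move=> mm a b /eqP w; apply/eqP/(walk_mono mm). Qed.

Lemma valid_perm root m nx vs rs rs' f :
  perm_eq rs rs' -> valid root m nx vs rs f -> valid root m nx vs rs' f.
Proof.
move=> pe v; have pp : perm_eq (pending rs) (pending rs') by apply/perm_map/perm_flatten.
case: v => v1 v2 v3 v4 v5 v6 v7 v8 v9; split=> //.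
- by move=> d dd dN; rewrite -(perm_mem pp); apply: v3.
- by move=> d; rewrite -(perm_mem pp); apply: v4.
- by rewrite -(perm_uniq pp).
- by move=> q; rewrite -(perm_mem pe); apply: v6.
Qed.

Lemma valid_rot root m nx vs q n rs f :
  valid root m nx vs (q :: rs) f -> valid root m nx vs (rot n q :: rs) f.
Proof.
move=> v; have pp : perm_eq (pending (q :: rs)) (pending (rot n q :: rs)).
  by rewrite !pending_cons perm_cat2r map_rot perm_sym perm_rot.
case: v => v1 v2 v3 v4 v5 v6 v7 v8 v9; split=> //.
- by move=> d dd dN; rewrite -(perm_mem pp); apply: v3.
- by move=> d; rewrite -(perm_mem pp); apply: v4.
- by rewrite -(perm_uniq pp).
- move=> q'; rewrite inE => /predU1P[->|qr]; last by apply: v6; rewrite inE qr orbT.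
  by rewrite rot_cycle; apply: v6; rewrite inE eqxx.
Qed.

Lemma valid_add root m nx vs q rs f :
  valid root m nx vs (q :: rs) f -> valid root m nx vs (add_region q rs) f.
Proof.
case: q => // -[v1 v2 v3 v4 v5 v6 v7 v8 v9]; split=> // q qr.
by apply: v6; rewrite inE qr orbT.
Qed.

Lemma valid_seg root m nx vs rs f (q : region) a :
  valid root m nx vs rs f -> q \in rs -> a \in q -> a.1 <= 5.
Proof.
move=> v qr aq; rewrite leqNgt; apply/negP => a5.
have /eqP := prev_cycle (v_cycle v qr) aq; set b := prev q a.
have bq : b \in q by rewrite mem_prev.
have /(v_pend v)[bd bN] : b.2 \in pending rs.
  by apply/map_f/flattenP; exists q.
rewrite -(subnKC a5) => /walk_prefix[c].
exact: (no_long_walk (v_emb v) bd bN).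
Qed.

Lemma near_mono (A B : {set dart F}) : A \subset B -> forall a b,
  connect (near e r A) a b -> connect (near e r B) a b.
Proof.
move=> /subsetP AB; apply: connect_sub => a b /or3P[/eqP->|/eqP->|/eqP->].
- exact: conn_rot.
- by rewrite (conn_sym _ (@drevK F)) conn_rot.
- rewrite /rev_on; case: ifP => // /andP[/AB aB /AB eaB]; apply: connect1.
  by rewrite /near /= /rev_on aB eaB eqxx !orbT.
Qed.

Lemma mem_matched m vs f d : {in darts vs &, injective f} -> d \in darts vs ->
  (f d \in matched m vs f) = (mate m d != None).
Proof.
move=> inj dd; rewrite inE; apply/hasP/idP => [[d' d'd /andP[/eqP E]]|n].
  by rewrite (inj _ _ d'd dd E).
by exists d; rewrite ?eqxx.
Qed.

Lemma matched_closed m vs f : embedded m vs f -> closed_set e (matched m vs f).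
Proof.
move=> emb z; rewrite inE => /hasP[d dd /andP[/eqP<-]].
case E: (mate m d) => [d'|//] _; have [_ E' <-] := emb_mate emb E.
by rewrite mem_matched ?E' ?(mate_dart emb E) //; exact: (emb_inj emb).
Qed.

(** The Jordan curve theorem as the search needs it: the explored part is connected and [F] is
    plane, so both darts of an unexplored edge lie on one face cycle of the explored part; the
    unmatched darts on the cycle through [x] are those of [q]. *)
Lemma mate_in_region root m nx vs q rs f x y :
  valid root m nx vs (q :: rs) f -> x \in map snd q -> y \in darts vs ->
  f y = e (f x) -> y \in map snd q.
Proof.
move=> v xq yd fy; have emb := v_emb v.
have sub d : d \in map snd q ->
    d \in pending (q :: rs) by rewrite pending_cons mem_cat => ->.
have [xd xN] := v_pend v (sub x xq).
have yN : mate m y = None.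
  case E: (mate m y) => [z|//]; have [_ E' fz] := emb_mate emb E.
  move: fz E'; rewrite fy drevK => /(emb_inj emb)-> //; first by rewrite xN.
  exact: (mate_dart emb E).
have xA : f x \notin matched m vs f by rewrite mem_matched ?xN //; exact: (emb_inj emb).
have cxy : connect (near e r (matched m vs f)) (f x) (e (f x)).
  rewrite -fy; apply: connect_trans (v_conn v yd).
  by rewrite (conn_sym _ (@drevK F)); apply: v_conn v _ xd.
have := jordan (@drev_neq F) (matched_closed emb) xA (euler_dart HF) cxy.
rewrite -fy => /porbitP[i iE].
have [b0 b0q xb0] := mapP xq.
(* The face cycle from [f x] never leaves the boundary of [q]: after [j] steps it is at a dart [d]
   from which [k] explored edges lead to an unmatched dart [b] of [q]. As [y] is itself unmatched,
   [k] is 0 when [y] is reached. *)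
have track j : exists d k, [/\ d \in darts vs,
    (face_on r (@drevK F) (matched m vs f) ^+ j)%g (f x) = f d
    & exists2 b, b \in q & walk m k d = Some b.2].
  elim: j => [|j [d [k [dd jE [b bq wb]]]]].
    by exists x, 0; split; rewrite ?expg0 ?perm1 //; exists b0; rewrite // xb0.
  rewrite expgSr permM jE face_onE.
  have dE : (f d \in matched m vs f) = (mate m d != None) by rewrite mem_matched //;
      exact: (emb_inj emb).
  case: k wb => [|k] /=.
    case=> db; have [_ dN] : d \in darts vs /\ mate m d = None.
      by apply: (v_pend v); apply: sub; rewrite db; apply: map_f.
    exists (rotp d), (next q b).1; split; first exact: darts_rot.
      by rewrite /rev_on dE dN /= (emb_rot emb).
    exists (next q b); first by rewrite mem_next.
    have cq : path.cycle (linked m) q by apply: (v_cycle v); rewrite inE eqxx.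
    by rewrite db; apply/eqP; exact: (next_cycle cq bq).
  case E: (mate m d) => [d'|//] w; exists (rotp d'), k; have [_ _ fd'] := emb_mate emb E.
  split; [exact/darts_rot/(mate_dart emb E) | | by exists b].
  rewrite /rev_on dE E (matched_closed emb) ?dE ?E //=.
  by rewrite (emb_rot emb) ?(mate_dart emb E) // fd'.
have [d [k [dd E [b bq]]]] := track i.
rewrite E in iE; have yd' := emb_inj emb yd dd iE; rewrite -yd'.
by case: k => [[->]|k /=]; [apply: map_f | rewrite yN].
Qed.
Lemma path_linked m s s' z q : path (linked m) (s, z) q = path (linked m) (s', z) q.
Proof. by case: q. Qed.

Lemma lengthen_snd k q : map snd (lengthen k q) = map snd q.
Proof. by case: q => [|[? ?] ?]. Qed.

Lemma lengthen_cycle m m' s z q t y :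
  (forall a b, mate m a = Some b -> mate m' a = Some b) -> mate m' y = Some z ->
  path (linked m) (s, z) q -> linked m (last (s, z) q) (t, y) ->
  path.cycle (linked m') (lengthen (t + 1) q).
Proof.
move=> mm yz; case: q => [//|[s1 x1] q] /= /andP[/eqP w1 pq] /eqP wy.
rewrite rcons_path; have sl := linked_sub mm; apply/andP; split.
  by rewrite (path_linked _ _ s1); apply: sub_path sl _ _ pq.
rewrite /linked /= (_ : (last _ q).2 = (last (s1, x1) q).2); last by case: q {pq wy}.
by rewrite -addnA (walk_cat _ (walk_mono mm wy)) /= yz (walk_mono mm w1).
Qed.

Lemma mate_link_sub x y m : mate m x = None -> mate m y = None ->
  forall a b, mate m a = Some b -> mate (link x y m) a = Some b.
Proof.
move=> xN yN a b E; rewrite mate_link.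
by case: eqVneq E => [->|_]; rewrite ?xN //; case: eqVneq => [->|_]; rewrite ?yN.
Qed.

Lemma valid_link root m nx vs s x r1 t y r2 rest f :
  valid root m nx vs (((s, x) :: r1 ++ (t, y) :: r2) :: rest) f -> f y = e (f x) ->
  valid root (link x y m) nx vs (lengthen (t + 1) r1 :: lengthen (s + 1) r2 :: rest) f.
Proof.
move=> v fy; have emb := v_emb v; have := v_uniq v.
set q := _ :: _ ++ _ in v *; set rs' := lengthen (t + 1) r1 :: _.
have pE : perm_eq (pending (q :: rest)) [:: x, y & pending rs'].
  rewrite !pending_cons !lengthen_snd /= map_cat /= perm_cons -!catA.
  by rewrite perm_catCA /= perm_cons perm_catCA.
rewrite (perm_uniq pE) /= inE negb_or -andbA => /and4P[xy xp yp up].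
have pm d : (d \in pending (q :: rest)) = [|| d == x, d == y | d \in pending rs'].
  by rewrite (perm_mem pE) !inE.
have [xd xN] : x \in darts vs /\ mate m x = None by apply: (v_pend v); rewrite pm eqxx.
have [yd yN] : y \in darts vs /\ mate m y = None by apply: (v_pend v); rewrite pm eqxx orbT.
have ms := mate_link_sub xN yN.
have cq : path.cycle (linked m) q by apply: (v_cycle v); rewrite inE eqxx.
move: cq; rewrite /q /path.cycle rcons_cat cat_path rcons_cons /= => /and3P[p1 l1].
rewrite rcons_path => /andP[p2 l2].
split.
- split; [exact: (emb_inj emb) | exact: (emb_rot emb) |] => d d'; rewrite !mate_link.
  case: (eqVneq d x) => [->[<-]|dx].
    by rewrite (eq_sym y) (negPf xy) eqxx.
  case: (eqVneq d y) => [->[<-]|dy]; first by rewrite eqxx fy drevK.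
  move=> E; have [dd E' ->] := emb_mate emb E; split=> //.
  by rewrite ifN ?ifN //; apply/eqP => E2; rewrite E2 ?xN ?yN in E'.
- exact: (v_fresh v).
- move=> d dd; rewrite mate_link; case: (eqVneq d x) => // dx;
    case: (eqVneq d y) => // dy dN.
  by have := v_open v dd dN; rewrite pm (negPf dx) (negPf dy).
- move=> d dp; have [dd dN] : d \in darts vs /\ mate m d = None by apply: (v_pend v);
    rewrite pm dp !orbT.
  by rewrite mate_link ifN ?ifN //; apply/eqP => E; move: dp;
      rewrite E ?(negPf xp) ?(negPf yp).
- exact: up.
- move=> q'; rewrite !inE => /or3P[/eqP->|/eqP->|qr].
  + by apply: (lengthen_cycle (s := s) ms _ p1 l1);
      rewrite mate_link (eq_sym y) (negPf xy) eqxx.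
  + by apply: (lengthen_cycle ms _ p2 l2); rewrite mate_link eqxx.
  + have : path.cycle (linked m) q' by apply: (v_cycle v); rewrite inE qr orbT.
    exact: (sub_cycle (linked_sub ms)).
- move=> d dd; apply: near_mono (v_conn v dd); apply/subsetP => z;
    rewrite !inE => /hasP[d' d'd].
  case/andP=> zE; case E: (mate m d') => [d''|//] _; apply/hasP; exists d' => //.
  by rewrite zE (ms _ _ E).
- exact: (v_root v).
- exact: (v_pent v).
Qed.
Definition new_region s nx (ys : region) : region :=
  if ys is _ :: _ then (s + 1, dart1 nx) :: (0, dart2 nx) :: lengthen 1 ys
  else [:: (s + 2, dart1 nx); (0, dart2 nx)].

Definition extend_map (f : positive -> dart F) nx z d :=
  if vert d == nx then
    if d == dart0 nx then z else if d == dart1 nx then r z else r (r z)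
  else f d.

Lemma dart10 v : (dart1 v == dart0 v) = false. Proof. by []. Qed.
Lemma dart20 v : (dart2 v == dart0 v) = false. Proof. by []. Qed.
Lemma dart21 v : (dart2 v == dart1 v) = false. Proof. by []. Qed.

Lemma new_region_snd s nx ys :
  map snd (new_region s nx ys) = [:: dart1 nx, dart2 nx & map snd ys].
Proof. by case: ys => [|[? ?] ?]. Qed.

Lemma valid_new root m nx vs s x ys rest f :
  valid root m nx vs (((s, x) :: ys) :: rest) f ->
  {in darts vs, forall d, f d != e (f x)} ->
  valid root (link x (dart0 nx) m) (Pos.succ nx) (nx :: vs) (new_region s nx ys :: rest)
    (extend_map f nx (e (f x))).
Proof.
move=> v fn; have emb := v_emb v; set g := extend_map _ _ _; set z := e (f x) in fn g *.
have fresh : nx \notin vs by apply/negP => /(v_fresh v)/Pos.lt_irrefl.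
have old d : d \in darts vs -> g d = f d.
  rewrite mem_darts => /andP[dv _]; rewrite /g /extend_map ifN //.
  by apply: contraNneq fresh => <-.
have g0 : g (dart0 nx) = z by rewrite /g /extend_map /= !eqxx.
have g1 : g (dart1 nx) = r z by rewrite /g /extend_map (_ : vert _ = nx) // eqxx dart10
    eqxx.
have g2 : g (dart2 nx) = r (r z) by rewrite /g /extend_map (_ : vert _ = nx) // eqxx dart20
    dart21.
have dE : darts (nx :: vs) = [:: dart0 nx, dart1 nx, dart2 nx & darts vs] by [].
have fresh_dart d : d \in darts vs -> vert d != nx.
  by rewrite mem_darts => /andP[dv _]; apply: contraNneq fresh => <-.
have sub d : d \in darts vs -> d \in darts (nx :: vs) by rewrite dE !inE => ->;
    rewrite !orbT.
have [xd xN] : x \in darts vs /\ mate m x = None by apply: (v_pend v);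
    rewrite pending_cons inE eqxx.
have n0N : mate m (dart0 nx) = None.
  by case E: (mate m _) => [d|//]; have [/fresh_dart] := emb_mate emb E; rewrite eqxx.
have ms := mate_link_sub xN n0N.
have x0 : x != dart0 nx by apply: contraNneq (fresh_dart x xd) => ->.
(* The darts of the map come in whole rotation orbits; if the image met one dart at the tail of [z],
   it would contain [z]. *)
have fk d : d \in darts vs -> [/\ f d != z, f d != r z & f d != r (r z)].
  move=> dd; split; first exact: fn.
    have := fn _ (darts_rot (darts_rot dd)); rewrite !(emb_rot emb) ?darts_rot //.
    by apply: contraNneq => ->; rewrite rotation3.
  have := fn _ (darts_rot dd); rewrite (emb_rot emb) //.
  by apply: contraNneq => ->; rewrite rotation3.
have rn := rotation_uniq HF z; rewrite /= !inE negb_or andbT in rn;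
    case/andP: rn => /andP[r1 r2] r3.
have cy : path.cycle (linked m) ((s, x) :: ys) by apply: (v_cycle v); rewrite inE eqxx.
have pE : pending (new_region s nx ys :: rest) = [:: dart1 nx, dart2 nx &
    map snd ys ++ pending rest].
  by rewrite pending_cons new_region_snd.
split.
- split.
  + have inj3 : {in [:: dart0 nx; dart1 nx; dart2 nx] &, injective g}.
      move=> a b; rewrite !inE => /or3P[]/eqP-> /or3P[]/eqP->;
          rewrite ?g0 ?g1 ?g2 // => /eqP;
      by rewrite ?(negPf r1) ?(negPf r2) ?(negPf r3) // eq_sym ?(negPf r1) ?(negPf r2)
          ?(negPf r3).
    have mix a b : a \in darts vs -> b \in [:: dart0 nx; dart1 nx; dart2 nx] -> g a != g b.
      move=> ad; have [f0 f1 f2] := fk a ad; rewrite !inE old //.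
      by case/or3P=> /eqP->; rewrite ?g0 ?g1 ?g2.
    have dm a : (a \in darts (nx :: vs)) = (a \in [:: dart0 nx; dart1 nx;
        dart2 nx]) || (a \in darts vs).
      by rewrite dE !inE -!orbA.
    move=> a b; rewrite !dm; case/orP=> [a3|ad] /orP[b3|bd].
    * exact: inj3.
    * by move/esym/eqP; rewrite (negPf (mix _ _ bd a3)).
    * by move/eqP; rewrite (negPf (mix _ _ ad b3)).
    * by rewrite !old //; apply: (emb_inj emb).
  + move=> d; rewrite dE !inE => /or4P[/eqP->|/eqP->|/eqP->|dd].
    * by rewrite g0 g1.
    * by rewrite g1 g2.
    * by rewrite g2 rotation3 // g0.
    * by rewrite !old ?darts_rot // (emb_rot emb).
  + move=> d d'; rewrite !mate_link.
    case: (eqVneq d x) => [->[<-]|dx].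
      by rewrite eq_sym (negPf x0) eqxx g0 old //; split=> //; apply: sub.
    case: (eqVneq d (dart0 nx)) => [->[<-]|d0].
      by rewrite eqxx g0 old // drevK; split=> //; rewrite dE inE eqxx.
    move=> E; have [dd E' fd'] := emb_mate emb E; have d'd := mate_dart emb E.
    rewrite !old //; split=> //; first exact: sub.
    by rewrite ifN ?ifN //; apply/eqP => E2; rewrite E2 ?xN ?n0N in E'.
- move=> w; rewrite inE => /predU1P[->|/(v_fresh v)]; lia.
- move=> d; rewrite dE !inE mate_link pE !inE.
  case: (eqVneq d x) => // dx; case: (eqVneq d (dart0 nx)) => //= d0.
  case: eqVneq => //= d1; case: eqVneq => //= d2 dd dN.
  by have := v_open v dd dN; rewrite pending_cons /= inE (negPf dx).
- move=> d dp; have {dp} : [|| d == dart1 nx,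
    d == dart2 nx | d \in map snd ys ++ pending rest].
    by move: dp; rewrite pE !inE.
  case/or3P=> [/eqP->|/eqP->|dp].
  + rewrite mate_link dE !inE eqxx ?orbT; split=> //; rewrite ifN ?ifN //.
      by case E: (mate m _) => [d'|//]; have [/fresh_dart] := emb_mate emb E; rewrite eqxx.
    by apply: contraNneq (fresh_dart x xd) => <-.
  + rewrite mate_link dE !inE eqxx ?orbT; split=> //; rewrite ifN ?ifN //.
      by case E: (mate m _) => [d'|//]; have [/fresh_dart] := emb_mate emb E; rewrite eqxx.
    by apply: contraNneq (fresh_dart x xd) => <-.
  + have [dd dN] : d \in darts vs /\ mate m d = None.
      by apply: (v_pend v); rewrite pending_cons inE dp orbT.
    split; first exact: sub.
    rewrite mate_link ifN ?ifN //; first by apply: contraNneq (fresh_dart d dd) => ->.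
    apply: contraTneq dp => ->; have := v_uniq v; rewrite pending_cons /=.
    by case/andP.
- rewrite pE !cons_uniq in_cons negb_or; have := v_uniq v.
  rewrite pending_cons /= => /andP[_ ->].
  have np d : vert d = nx -> d \notin map snd ys ++ pending rest.
    move=> dn; apply/negP => dp; have [/fresh_dart] : d \in darts vs /\ mate m d = None.
      by apply: (v_pend v); rewrite pending_cons inE dp orbT.
    by rewrite dn eqxx.
  by rewrite !np.
- move=> q'; rewrite !inE => /predU1P[->|qr]; last first.
    have : path.cycle (linked m) q' by apply: (v_cycle v); rewrite inE qr orbT.
    exact: (sub_cycle (linked_sub ms)).
  have m0 : mate (link x (dart0 nx) m) (dart0 nx) = Some x.
    by rewrite mate_link eq_sym (negPf x0) eqxx.
  have mx : mate (link x (dart0 nx) m) x = Some (dart0 nx) by rewrite mate_link eqxx.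
  set m' := link _ _ _ in ms m0 mx *.
  have L1 a : linked m' (a, dart1 nx) (0, dart2 nx) by exact: eqxx.
  have L2 a k w : walk m' k (dart0 nx) = Some w -> linked m' (a, dart2 nx) (k,
      w) by move/eqP.
  have w0 k w : walk m' k (rotp x) = Some w -> walk m' k.+1 (dart0 nx) = Some w.
    by move=> h; rewrite /= m0.
  clear pE; case: ys cy v => [|[t y] ys] + v.
    rewrite /path.cycle /= andbT => /eqP /= w; rewrite L1 andbT /=.
    by rewrite addn2; apply/L2/w0; rewrite -[s.+1]addn1 (walk_cat _ (walk_mono ms w)) /= mx.
  rewrite /path.cycle /= => /andP[/eqP /= w1]; rewrite !rcons_path => /andP[p1 /eqP w2].
  rewrite L1 add1n (L2 _ _ _ (w0 _ _ (walk_mono ms w1))) /=.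
  rewrite (path_linked _ _ t) (sub_path (linked_sub ms) p1) /=; apply/eqP => /=.
  rewrite (_ : (last _ ys).2 = (last (t, y) ys).2); last by case: ys {p1 w2 v}.
  by rewrite (walk_cat _ (walk_mono ms w2)) /= mx.
- have sm : matched m vs f \subset matched (link x (dart0 nx) m) (nx :: vs) g.
    apply/subsetP => w; rewrite !inE => /hasP[d dd /andP[wd md]]; apply/hasP; exists d;
        first exact: sub.
    by rewrite old // wd; case E: (mate m d) md => [d'|//]; rewrite (ms _ _ E).
  have co d : d \in darts vs ->
      connect (near e r (matched (link x (dart0 nx) m) (nx :: vs) g)) (g root) (g d).
    by move=> dd; rewrite !old ?(v_root v) //; apply: near_mono sm _ _ (v_conn v dd).
  have c0 : connect (near e r (matched (link x (dart0 nx) m) (nx :: vs) g)) (g root) z.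
    apply: connect_trans (co x xd) _; rewrite old //; apply: connect1;
        rewrite /near /= /rev_on.
    have mm d d' : mate (link x (dart0 nx) m) d = Some d' -> d \in darts (nx :: vs) -> 
      g d \in matched (link x (dart0 nx) m) (nx :: vs) g.
      by move=> E dd; rewrite inE; apply/hasP; exists d; rewrite ?eqxx ?E.
    have m1 : f x \in matched (link x (dart0 nx) m) (nx :: vs) g.
      by rewrite -old //; apply: (mm x (dart0 nx)); [rewrite mate_link eqxx | apply: sub].
    have m2 : z \in matched (link x (dart0 nx) m) (nx :: vs) g.
      rewrite -g0; apply: (mm (dart0 nx) x); last by rewrite dE inE eqxx.
      by rewrite mate_link eq_sym (negPf x0) eqxx.
    by rewrite m1 -/z m2 eqxx !orbT.
  move=> d; rewrite dE !inE => /or4P[/eqP->|/eqP->|/eqP->|/co//].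
  + by rewrite g0.
  + by rewrite g1; apply: connect_trans c0 (conn_rot _ _ _ _).
  + rewrite g2; apply: connect_trans c0 _.
    by apply: connect_trans (conn_rot _ _ _ _) (conn_rot _ _ _ _).
- exact: sub (v_root v).
- by rewrite old ?(v_root v) // (v_pent v).
Qed.
End State.

(** * Forced edges *)

Section Matching.
Variables (F : plane_graph) (M : {set {set F}}).
Hypothesis pM : perfect_matching M.

Lemma matching_dart x : exists2 d : dart F, dtail d = x & edge_of d \in M.
Proof.
have [sM /(_ x) c1] := pM.
have /card_gt0P[E] : 0 < #|[set E in M | x \in E]| by rewrite c1.
rewrite inE => /andP[EM]; have := subsetP sM E EM.
rewrite edgesE => /imsetP[d _ Ed]; rewrite {}Ed in EM *; rewrite !inE => /orP[]/eqP->.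
  by exists d.
by exists (drev d); rewrite ?edge_of_drev.
Qed.

Lemma matching_inj (d d' : dart F) : edge_of d \in M -> edge_of d' \in M ->
    dtail d = dtail d' -> d = d'.
Proof.
move=> dM d'M t; have [_ /(_ (dtail d)) /eqP/cards1P[E EE]] := pM.
have : edge_of d \in [set E in M | dtail d \in E] by rewrite inE dM !inE eqxx.
have : edge_of d' \in [set E in M | dtail d \in E] by rewrite inE d'M t !inE eqxx.
rewrite EE !inE => /eqP <- /eqP /esym/edge_of_eq[] // E'.
by move: t => /eqP; rewrite E' dtail_drev 1?eq_sym (negPf (dtail_neq _)).
Qed.
End Matching.

Section Alternating.
Variables (F : plane_graph) (M : {set {set F}}) (c : {set dart F}).
Hypotheses (pM : perfect_matching M) (cf : c \in faces F) (aM : alternating M c).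

Lemma alternating_closed (d : dart F) :
  edge_of d \in M -> dtail d \in face_vertices c -> dhead d \in face_vertices c.
Proof.
move=> dM /imsetP[a ac t]; have [a0 _ ca] := imsetP cf.
have nc b : b \in c -> next_dart F b \in c.
  by rewrite ca => /porbitP[i ->]; rewrite -permM -expgSr mem_porbit.
have [a' a'c aE] : exists2 a', a' \in c & next_dart F a' = a.
  exists ((next_dart F)^-1 a)%g; last by rewrite permKV.
  move: ac; rewrite ca -!eq_porbit_mem => /eqP <-; rewrite eq_porbit_mem -porbitV.
  by have := mem_porbit (next_dart F)^-1 1 a; rewrite expg1.
have tn b : dtail (next_dart F b) = dhead b by rewrite next_dartE dtail_rotation.
case: (boolP (edge_of a \in M)) => aMa.
  by rewrite (matching_inj pM dM aMa t) -tn; apply/imset_f/nc.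
have a'M : edge_of a' \in M by rewrite (aM a'c) aE.
have -> : d = drev a'.
  by apply: (matching_inj pM dM); rewrite ?edge_of_drev // t -aE tn.
exact: imset_f.
Qed.
End Alternating.

Section Chain.
Variables (F : plane_graph).
Hypothesis HF : fullerene F.
Hypothesis res3 : k_resonant F 3.
Variables (m : mates) (vs : seq positive) (f : positive -> dart F).
Hypothesis emb : embedded m vs f.
Local Notation phi := (next_dart F).

Definition hexagon_list h :=
  exists d l, hexagon_at m d = Some l /\ h = map vert l.
Definition apart_hexagons (H : seq (seq positive)) :=
  (forall h, h \in H -> hexagon_list h) /\ pairwise apart H.
(* All that is needed of a matching alternating on the hexagon with vertices [h]. *)
Definition respects (M : {set {set F}}) (h : seq positive) :=
  forall d, d \in darts vs -> edge_of (f d) \in M -> vert d \in h ->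
  exists2 d', d' \in darts vs & vert d' \in h /\ dtail (f d') = dhead (f d).

Lemma face_vertices_hexagon d l x : hexagon_at m d = Some l ->
  (x \in face_vertices (porbit phi (f d))) = (x \in map (fun a => dtail (f a)) l).
Proof.
case/(hexagon_atP HF emb) => _ _ pl _ _; rewrite (map_comp (@dtail F) f).
by apply/imsetP/mapP => -[a ad ->]; exists a => //; rewrite ?pl // -pl.
Qed.

Lemma hexagon_vert d l a : hexagon_at m d = Some l -> a \in darts vs ->
  (vert a \in map vert l) = (dtail (f a) \in face_vertices (porbit phi (f d))).
Proof.
move=> hd ad; have [_ _ _ _ sub] := hexagon_atP HF emb hd.
rewrite (face_vertices_hexagon _ hd); apply/mapP/mapP => -[b bl /eqP E]; exists b => //;
    apply/eqP.
  by rewrite -(vert_dtail HF emb ad (sub _ bl)).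
by rewrite (vert_dtail HF emb ad (sub _ bl)).
Qed.

Lemma respects_alternating (M : {set {set F}}) d l : perfect_matching M ->
  hexagon_at m d = Some l -> alternating M (porbit phi (f d)) -> respects M (map vert l).
Proof.
move=> pM hd aM a ad aMa; rewrite (hexagon_vert hd ad) => al.
have pf : porbit phi (f d) \in faces F by apply: imset_f.
have := alternating_closed pM pf aM aMa al; rewrite (face_vertices_hexagon _ hd).
case/mapP=> b bl ->; have [_ _ _ _ sub] := hexagon_atP HF emb hd.
by exists b; rewrite ?sub ?map_f.
Qed.

Lemma apart_disjoint d l d' l' : hexagon_at m d = Some l -> hexagon_at m d' = Some l' ->
  apart (map vert l) (map vert l') ->
  [disjoint face_vertices (porbit phi (f d)) & face_vertices (porbit phi (f d'))].
Proof.
move=> hd hd' ap; apply/pred0P => x /=; apply/negbTE/negP => /andP[].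
rewrite (face_vertices_hexagon _ hd) => /mapP[a al ->].
have [_ _ _ _ sub] := hexagon_atP HF emb hd.
rewrite -(hexagon_vert hd') ?sub // => al'; case/negP: ap; apply/hasP.
by exists (vert a); rewrite ?map_f.
Qed.

(** This is where 3-resonance enters. The list [H] is turned into a set of faces of [F]; only an
    upper bound on its cardinality is needed. *)
Lemma resonant_matching H : apart_hexagons H -> size H <= 3 ->
  exists2 M : {set {set F}}, perfect_matching M & forall h, h \in H -> respects M h.
Proof.
case=> hH pH sH.
have [C [dC cC aC _]] : exists C : {set {set dart F}}, [/\ disjoint_hexagons C,
    #|C| <= size H,
    forall h, h \in H -> exists d l, [/\ hexagon_at m d = Some l, h = map vert l &
        porbit phi (f d) \in C] &
    forall c, c \in C -> exists d l, [/\ hexagon_at m d = Some l, map vert l \in H &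
        c = porbit phi (f d)]].
  elim: H hH pH {sH} => [|h H IH] hH pH.
    exists set0; split=> //; [|by rewrite cards0|by move=> c; rewrite inE].
    by split; [rewrite sub0set | move=> a b; rewrite inE].
  have hH' h' : h' \in H -> hexagon_list h' by move=> h'H; apply: hH; rewrite inE h'H orbT.
  have pH' : pairwise apart H by move: pH => /= /andP[].
  have [C [[C1 C2] C3 C4 C5]] := IH hH' pH'.
  have [d [l [hd hl]]] := hH h (mem_head _ _).
  have [_ ph _ _ _] := hexagon_atP HF emb hd.
  have dis c : c \in C -> [disjoint face_vertices (porbit phi (f d)) & face_vertices c].
    move=> /C5[d' [l' [hd' l'H ->]]]; apply: apart_disjoint hd hd' _.
    by move: pH => /= /andP[/allP/(_ _ l'H)]; rewrite hl.
  exists (porbit phi (f d) |: C); split.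
  - split=> [|a b]; first by rewrite subUset sub1set ph.
    rewrite !inE => /predU1P[->|aC] /predU1P[->|bC]; rewrite ?eqxx // => ab.
    + exact: dis.
    + by rewrite disjoint_sym; apply: dis.
    + exact: C2.
  - by rewrite cardsU1 /= -add1n leq_add // leq_b1.
  - move=> h'; rewrite inE => /predU1P[->|/C4[d' [l' [hd' l'H c']]]].
      by exists d, l; rewrite setU11.
    by exists d', l'; rewrite setU1r.
  - move=> c /setU1P[->|/C5[d' [l' [hd' l'H ->]]]].
      by exists d, l; rewrite -hl mem_head.
    by exists d', l'; rewrite in_cons l'H orbT.
have [_ [M pM aM]] := res3 (leq_trans cC sH) dC erefl.
exists M => // h /aC[d [l [hd -> dC']]]; exact: respects_alternating pM hd (aM _ dC').
Qed.

(** The head of [d] is matched inside its hexagon, so it cannot be matched to the tail of [d] when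
    that tail is on no hexagon of [H']. *)
Lemma block_apart H H' d : block m H d = Some H' -> apart_hexagons H -> size H <= 3 ->
  [/\ apart_hexagons H', size H' <= 3, {subset H <= H'} &
    forall M : {set {set F}}, (forall h, h \in H' -> respects M h) -> perfect_matching M ->
      d \in darts vs -> vert d \notin flatten H' -> edge_of (f d) \notin M].
Proof.
rewrite /block; case md: (mate m d) => [a|//].
have ad := mate_dart emb md; have [dd _ fa] := emb_mate emb md.
have key h H1 : h \in H1 -> vert a \in h -> forall M : {set {set F}}, (forall h,
    h \in H1 -> respects M h) ->
   perfect_matching M -> d \in darts vs -> vert d \notin flatten H1 ->
       edge_of (f d) \notin M.
  move=> hH1 ah M /(_ h hH1) rM pM _; apply: contra => dM.
  have [|d' d'd [d'h t]] := rM a ad _ ah; first by rewrite fa edge_of_drev.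
  apply/flattenP; exists h => //; rewrite (_ : vert d = vert d') //; apply/eqP.
  by rewrite (vert_dtail HF emb) // t fa dhead_drev.
case: ifP => [/flattenP[h hH ah] [<-]|_]; first by move=> oH sH; split=> //;
    apply: key hH ah.
case: ifP => // sH; case hx: (hexagon_at m _) => [l|//].
case: ifP => // apl [<-] [hH pH] _; split=> //.
- split=> [h|]; last by rewrite /= apl pH.
  by rewrite inE => /predU1P[->|/hH//]; exists (rotp (rotp a)), l.
- by move=> h hH'; rewrite inE hH' orbT.
- apply: (key (map vert l)); first exact: mem_head.
  rewrite -[vert a]vert_rotp -vert_rotp (hexagon_vert hx) ?darts_rot //.
  by apply: imset_f; apply: porbit_id.
Qed.

(** The tails in [T] must stay off the final hexagons [Hf], since the blocking arguments made
    earlier along the path rely on it. *)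
Definition forced (T : seq positive) d (H : seq (seq positive)) := exists Hf,
    [/\ apart_hexagons Hf, size Hf <= 3, {subset H <= Hf},
    (forall v, v \in vert d :: T -> v \notin flatten Hf) &
    forall M : {set {set F}}, (forall h, h \in Hf -> respects M h) -> perfect_matching M ->
      edge_of (f d) \in M].

Lemma sub_flatten (H H' : seq (seq positive)) v : {subset H <= H'} ->
    v \notin flatten H' -> v \notin flatten H.
Proof. by move=> s; apply: contra => /flattenP[h /s hH vh]; apply/flattenP; exists h. Qed.

Lemma avoidsP T H v : avoids T H -> v \in T -> v \notin flatten H.
Proof. by move=> /hasPn a /a. Qed.

Lemma third_dart (M : {set {set F}}) d : perfect_matching M -> d \in darts vs ->
  edge_of (f (rotp d)) \notin M -> edge_of (f (rotp (rotp d))) \notin M ->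
      edge_of (f d) \in M.
Proof.
move=> pM dd n1 n2; have [d' t d'M] := matching_dart pM (dtail (f d)).
have [] := rot_cases HF t; rewrite -?(emb_rot emb) ?darts_rot // => E;
    rewrite E in d'M => //.
  by rewrite d'M in n1.
by rewrite d'M in n2.
Qed.

(** The darts [a] and [d] are distinct and have the same head, so a matching contains at most one of
    their edges. *)
Lemma onwardP d a : a \in onward m d -> [/\ a \in darts vs, d \in darts vs &
   forall M : {set {set F}}, perfect_matching M -> edge_of (f a) \in M ->
       edge_of (f d) \notin M].
Proof.
rewrite /onward; case md: (mate m d) => [b|//].
have bd := mate_dart emb md; have [dd _ fb] := emb_mate emb md.
move=> ab; have [c [cd cb mc cne]] : exists c, [/\ c \in darts vs,
    dtail (f c) = dtail (f b), mate m c = Some a & f c != f b].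
  move: ab; rewrite mem_pmap => /mapP[c cc mc]; have [cd _ _] := emb_mate emb (esym mc).
  have := rotation_uniq HF (f b); rewrite /= !inE negb_or andbT => /andP[/andP[n1 n2] _].
  move: cc; rewrite !inE => /orP[]/eqP cE; exists c; split=> //; rewrite cE.
  - by rewrite (emb_rot emb) // dtail_rotation.
  - by rewrite (emb_rot emb) // eq_sym.
  - by rewrite !(emb_rot emb) ?darts_rot // !dtail_rotation.
  - by rewrite !(emb_rot emb) ?darts_rot // eq_sym.
have [_ _ fa] := emb_mate emb mc; split=> //; first exact: (mate_dart emb mc).
move=> M pM; rewrite fa edge_of_drev => cM; apply/negP => dM; case/negP: cne; apply/eqP.
by apply: (matching_inj pM) => //; rewrite fb edge_of_drev.
Qed.

Lemma block_free H H' d Hf (M : {set {set F}}) : block m H d = Some H' ->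
    apart_hexagons H -> size H <= 3 ->
  {subset H' <= Hf} -> (forall h, h \in Hf -> respects M h) -> perfect_matching M ->
  d \in darts vs -> vert d \notin flatten Hf -> edge_of (f d) \notin M.
Proof.
move=> b aH sH s rM pM dd dn; have [_ _ _ ->] := block_apart b aH sH => //.
  by move=> h /s; apply: rM.
exact: sub_flatten dn.
Qed.

Lemma forced_end T d H H' : blocks m H (rotp d) (rotp (rotp d)) = Some H' ->
  avoids (vert d :: T) H' -> d \in darts vs -> apart_hexagons H -> size H <= 3 ->
      forced T d H.
Proof.
rewrite /blocks; case b1: (block m H _) => [H1|//] b2 av dd aH sH.
have [aH1 sH1 s1 _] := block_apart b1 aH sH; have [aH2 sH2 s2 _] := block_apart b2 aH1 sH1.
have dn : vert d \notin flatten H' by apply: avoidsP av (mem_head _ _).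
exists H'; split=> // [h /s1/s2//|v|M rM pM]; first exact: avoidsP.
apply: third_dart => //.
- by apply: (block_free b1 aH sH s2 rM pM); rewrite ?darts_rot ?vert_rotp.
- by apply: (block_free b2 aH1 sH1 _ rM pM); rewrite ?darts_rot ?vert_rotp.
Qed.

Lemma forced_step T d H H1 a b c :
  (a, b) \in [:: (rotp d, rotp (rotp d)); (rotp (rotp d), rotp d)] ->
  block m H a = Some H1 -> c \in onward m b -> forced (vert d :: T) c H1 ->
  d \in darts vs -> apart_hexagons H -> size H <= 3 -> forced T d H.
Proof.
move=> ab b1 cb [Hf [aHf sHf sub av fM]] dd aH sH.
have [_ _ s1 _] := block_apart b1 aH sH.
have {}av v : v \in vert d :: T -> v \notin flatten Hf by move=> vT; apply: av;
    rewrite inE vT orbT.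
exists Hf; split=> // [h /s1/sub//|M rM pM].
have bM : edge_of (f b) \notin M by have [_ _ /(_ _ pM (fM _ rM pM))] := onwardP cb.
have dn := av _ (mem_head _ _).
have aM : edge_of (f a) \notin M.
  apply: (block_free b1 aH sH sub rM pM); move: ab; rewrite !inE !xpair_eqE;
  by case/orP=> /andP[/eqP-> _]; rewrite ?darts_rot ?vert_rotp.
move: ab; rewrite !inE !xpair_eqE => /orP[]/andP[/eqP E1 /eqP E2]; rewrite E1 E2 in aM bM;
exact: third_dart.
Qed.

Lemma chainP n H T d : chain n m H T d -> d \in darts vs -> apart_hexagons H ->
    size H <= 3 ->
  forced T d H.
Proof.
elim: n H T d => [|n IH] H T d /=.
  by rewrite orbF; case b: (blocks m H _ _) => [H'|//]; apply: forced_end b.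
case/orP=> [|/orP[]].
- by case b: (blocks m H _ _) => [H'|//]; apply: forced_end b.
- case b: (block m H _) => [H1|//] /hasP[c cb ch] dd aH sH; have [aH1 sH1 _ _] :=
    block_apart b aH sH.
  have [cd _ _] := onwardP cb.
  by apply: (forced_step _ b cb (IH _ _ _ ch cd aH1 sH1)) => //; rewrite !inE eqxx.
- case b: (block m H _) => [H1|//] /hasP[c cb ch] dd aH sH; have [aH1 sH1 _ _] :=
    block_apart b aH sH.
  have [cd _ _] := onwardP cb.
  by apply: (forced_step _ b cb (IH _ _ _ ch cd aH1 sH1)) => //; rewrite !inE eqxx orbT.
Qed.

(** With the other two neighbours of its tail blocked, [d] must be matched; but its head is blocked
    too, or is the end of another forced edge. The hexagons used number at most three, so
    3-resonance is contradicted. *)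
Lemma chain_fromP n d : d \in darts vs -> chain_from n m d = false.
Proof.
move=> dd; apply/negP; rewrite /chain_from /blocks.
have a0 : apart_hexagons [::] by [].
case b1: (block m _ _) => [H1|//]; case b2: (block m H1 _) => [H2|//].
have [aH1 sH1 s1 _] := block_apart b1 a0 isT; have [aH2 sH2 s2 _] := block_apart b2 aH1 sH1.
suff no Hf (M : {set {set F}}) : {subset H2 <= Hf} -> (forall h, h \in Hf ->
    respects M h) -> perfect_matching M ->
    vert d \notin flatten Hf -> edge_of (f d) \in M.
  case/orP.
    case b3: (block m H2 d) => [H3|//] av; have [aH3 sH3 s3 _] := block_apart b3 aH2 sH2.
    have [M pM rM] := resonant_matching aH3 sH3.
    have dn : vert d \notin flatten H3 by apply: avoidsP av (mem_head _ _).
    have := no _ _ s3 rM pM dn.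
    by rewrite (negPf (block_free b3 aH2 sH2 (fun _ h => h) rM pM dd dn)).
  case/hasP=> c cd ch; have [ccd _ cM] := onwardP cd.
  have [Hf [aHf sHf sub av fM]] := chainP ch ccd aH2 sH2.
  have [M pM rM] := resonant_matching aHf sHf.
  have dn : vert d \notin flatten Hf by apply: av; rewrite !inE eqxx orbT.
  by have := no _ _ sub rM pM dn; rewrite (negPf (cM _ pM (fM _ rM pM))).
move=> sub rM pM dn; apply: third_dart => //.
- by apply: (block_free b1 a0 isT _ rM pM); rewrite ?darts_rot ?vert_rotp // => h /s2/sub.
- by apply: (block_free b2 aH1 sH1 sub rM pM); rewrite ?darts_rot ?vert_rotp.
Qed.
End Chain.

(** * Correctness of the search *)

Lemma best_dartP p q a r : (exists n, a :: r = rot n (p ++ q)) ->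
  exists n, (best_dart p q a r).1 :: (best_dart p q a r).2 = rot n (p ++ q).
Proof.
elim: q p a r => [//|b q IH] p a r h /=; rewrite -cat_rcons in h *.
case: ifP => _; apply: IH => //; exists (size p).
by rewrite cat_rcons rot_size_cat.
Qed.

Lemma best_regionP q done rs :
  perm_eq ((best_region q done rs).1 :: (best_region q done rs).2) (q :: done ++ rs).
Proof.
elim: rs q done => [|q' rs IH] q done /=; first by rewrite cats0.
case: ifP => _; apply: perm_trans (IH _ _) _ => /=.
  by apply/seq.permP => P /=; rewrite !count_cat /=; lia.
by apply/seq.permP => P /=; rewrite !count_cat /=; lia.
Qed.

Lemma mem_splits p r1 y r2 : (p ++ r1, y, r2) \in splits p (r1 ++ y :: r2).
Proof.
elim: r1 p => [|z r1 IH] p /=; first by rewrite cats0 inE eqxx.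
by rewrite inE -cat_rcons IH orbT.
Qed.

Section Search.
Variables (F : plane_graph).
Hypothesis HF : fullerene F.
Hypothesis res3 : k_resonant F 3.
Local Notation phi := (next_dart F).
Local Notation r := (rotation F).
Local Notation e := (@drev F).
Variable root : positive.
Implicit Types (f : positive -> dart F) (q : region).

Lemma bad_faceP m nx vs rs f x : valid root m nx vs rs f -> bad_face root m x = false.
Proof.
move=> v; have emb := v_emb v; rewrite /bad_face.
case hx: (hexagon_at m x) => [l|//]; have [_ _ _ _ sub] := hexagon_atP HF emb hx.
apply/norP; split.
  case fr: (face m root) => [l'|//]; have [_ -> _] := faceP HF emb fr.
  by rewrite (v_pent v).
apply/hasPn => y yl; case md: (mate m _) => [d|//]; apply/hasPn => c.
have dd := mate_dart emb md.
by rewrite !inE => /or3P[]/eqP->; rewrite (chain_fromP HF res3 emb) ?darts_rot.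
Qed.

Lemma valid_add2 m nx vs q q' rs f :
  valid root m nx vs (q :: q' :: rs) f ->
      valid root m nx vs (add_region q (add_region q' rs)) f.
Proof.
move=> v; apply: valid_add; case: q' v => // v.
by apply: (@valid_add _ _ _ _ _ [::] (q :: rs)); apply: valid_perm v;
    apply/seq.permP => P /=; lia.
Qed.

Lemma closing_fits m vs f x y s : embedded m vs f -> mate m y = Some x ->
  walk m s (rotp x) = Some y -> 4 <= s.
Proof.
move=> emb yx w; rewrite leqNgt; apply/negP => s4.
have c : iter s.+1 phi (f y) = f y.
  by rewrite iterSr -(mate_next emb yx) -(walk_iter emb w).
have := short_cycle HF c; case: (card_face HF (f y)) => ->; lia.
Qed.

Lemma fits_lengthen m nx vs rs f t q : valid root m nx vs rs f -> q != [::] ->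
    lengthen (t + 1) q \in rs -> fits t q.
Proof. by move=> v; case: q => [//|[s y] q] _ /= qr; have :=
    valid_seg HF v qr (mem_head _ _). Qed.

Lemma joinableP m nx vs rs f x y : valid root m nx vs rs f -> x \in darts vs ->
    y \in darts vs ->
  mate m x = None -> f y = e (f x) -> joinable m x y.
Proof.
move=> v xd yd xN fy; have emb := v_emb v; apply/andP; split.
  by rewrite (vert_dtail HF emb) // fy dtail_drev dtail_neq.
apply/allP => z zx; case mz: (mate m z) => [d|//].
have dd := mate_dart emb mz; have [zd _ fd] := emb_mate emb mz.
rewrite (vert_dtail HF emb) // fd fy !dtail_drev; apply/eqP => E.
suff zE : z = x by rewrite zE xN in mz.
apply: (emb_inj emb) => //; apply: dart_eq E.
apply/eqP; rewrite -(vert_dtail HF emb) //; move: zx; rewrite !inE.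
by case/or3P=> /eqP->; rewrite ?vert_rotp.
Qed.

Variables (leaf : mates -> seq positive -> bool) (G : Prop).
Hypothesis leafP : forall m nx vs f, valid root m nx vs [::] f -> leaf m vs -> G.

(** Induction on the fuel: of the alternatives explored at a node, the one realised in [F] is shown
    to pass the tests and to satisfy [valid] again. *)
Lemma searchP n m nx vs rs f : search root leaf n m nx vs rs -> valid root m nx vs rs f ->
    G.
Proof.
elim: n m nx vs rs f => [//|n IH] m nx vs [|q0 rs0] f /=; first by move=> lf v;
    apply: leafP v lf.
have := best_regionP q0 [::] rs0; case: best_region => q rest /= pq.
case: q pq => [//|a q] pq.
have [k] : exists n, (best_dart [:: a] q a q).1 :: (best_dart [:: a] q a q).2 = rot n ([::
    a] ++ q).
  by apply: best_dartP; exists 0; rewrite rot0.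
case: best_dart => -[s x] ys /= rE H v0.
have {v0} v : valid root m nx vs (((s, x) :: ys) :: rest) f.
  by rewrite rE; apply: valid_rot; apply: valid_perm v0; rewrite perm_sym.
move: H => /andP[/allP old new]; have emb := v_emb v.
have [xd xN] : x \in darts vs /\ mate m x = None by apply: (v_pend v);
    rewrite pending_cons inE eqxx.
(* [F] decides the alternative: the reverse of [f x] has been seen already, or it leaves a new
   vertex. *)
case: (boolP (has (fun d => f d == e (f x)) (darts vs))) => [/hasP[y yd /eqP fy]|/hasPn fn].
  have := mate_in_region HF v (mem_head _ _) yd fy; rewrite inE => /predU1P[yx|].
    by move/eqP: fy; rewrite yx eq_sym (negPf (drev_neq _)).
  case/mapP=> -[t y'] ty /= E; rewrite -{}E {y'} in ty.
  case/splitPr: ty old new v => r1 r2 old _ v.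
  have := old _ (mem_splits [::] r1 (t, y) r2); rewrite /=.
  have v' := valid_link v fy.
  have mxy : mate (link x y m) x = Some y by rewrite mate_link eqxx.
  have [_ myx _] := emb_mate (v_emb v') mxy.
  have cy : path.cycle (linked m) ((s, x) :: r1 ++ (t, y) :: r2) by apply: (v_cycle v);
      rewrite inE eqxx.
  have yN : mate m y = None by have [] : y \in darts vs /\ mate m y = None
    by apply: (v_pend v); rewrite pending_cons mem_cat /= inE map_cat mem_cat /= inE eqxx
        !orbT.
  have ms := mate_link_sub xN yN.
  have ft : fits t r1.
    case: (eqVneq r1 [::]) => [r10|r1n]; last by apply: fits_lengthen v' r1n _;
        rewrite inE eqxx.
    rewrite r10 in cy *; move: cy => /= /andP[/eqP w _].
    exact: closing_fits (v_emb v') myx (walk_mono ms w).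
  have fs : fits s r2.
    case: (eqVneq r2 [::]) => [r20|r2n]; last by apply: fits_lengthen v' r2n _;
        rewrite !inE eqxx orbT.
    rewrite r20 in cy *; move: cy;
        rewrite /path.cycle rcons_cat cat_path /= => /and4P[_ _ /eqP w _].
    exact: closing_fits (v_emb v') mxy (walk_mono ms w).
  rewrite (joinableP v) // ft fs !(bad_faceP _ v') !andbF /= => /IH; apply.
  exact: valid_add2 v'.
have v' := valid_new HF v fn; move: new => {old}.
have seg a' : a' \in new_region s nx ys -> a'.1 <= 5 by apply: (valid_seg HF v');
    rewrite inE eqxx.
case: ys {rE v} v' seg => [|[t y] ys] v' seg.
  have s3 := seg _ (mem_head _ _); rewrite (_ : s < 4); last by move: s3 => /=; lia.
  by move/IH; apply; apply: v'.
have s4 := seg _ (mem_head _ _); have t4 := seg (1 + t, y).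
have -> : (s < 5) && (t < 5).
  have /= {}t4 := t4 _; move: s4 => /= s4; have {}t4 : 1 + t <= 5 by apply: t4;
      rewrite !inE eqxx !orbT.
  lia.
by move/IH; apply; apply: v'.
Qed.
End Search.

(** * Complete maps *)

Lemma apart_sym h u : apart h u = apart u h.
Proof. by rewrite /apart has_sym. Qed.

Lemma uniq_flatten_map (T S : eqType) (g : T -> seq S) (s : seq T) a b v :
  uniq (flatten (map g s)) -> a \in s -> b \in s -> v \in g a -> v \in g b -> a = b.
Proof.
elim: s => [//|c s IH] /=; rewrite cat_uniq => /and3P[_ /hasPn dis us].
have no d : d \in s -> v \in g c -> v \in g d -> False.
  move=> ds vc vd; have /dis/negP : v \in flatten (map g s) by apply/flatten_mapP; exists d.
  by apply.
rewrite !inE => /predU1P[->|as_] /predU1P[->|bs] va vb //; last exact: IH.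
  by case: (no b bs va vb).
by case: (no a as_ vb va).
Qed.

Lemma exists_lowest (s : seq positive) : s != [::] -> exists2 d, d \in s &
    all (Pos.leb d) s.
Proof.
elim: s => [//|a s IH] _; case: (eqVneq s [::]) => [->|/IH[d ds ld]].
  by exists a; rewrite ?mem_head //= Pos.leb_refl.
case: (boolP (Pos.leb a d)) => ad.
  exists a; rewrite ?mem_head //= Pos.leb_refl /=; apply/allP => b /(allP ld).
  by move: ad => /Pos.leb_spec0 ad /Pos.leb_spec0 db; apply/Pos.leb_spec0; lia.
exists d; rewrite ?inE ?ds ?orbT //= ld andbT.
by move: ad; case: Pos.leb_spec0 => // ad _; apply/Pos.leb_spec0; lia.
Qed.

Section Leaf.
Variables (F : plane_graph).
Hypothesis HF : fullerene F.
Hypothesis res3 : k_resonant F 3.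
Local Notation phi := (next_dart F).
Local Notation r := (rotation F).
Local Notation e := (@drev F).
Variables (root : positive) (m : mates) (nx : positive) (vs : seq positive) (f : positive
    -> dart F).
Hypothesis vld : valid root m nx vs [::] f.

Let emb := v_emb vld.

Lemma all_mated d : d \in darts vs -> exists d', mate m d = Some d'.
Proof.
by move=> dd; case md: (mate m d) => [d'|]; [exists d' | have := v_open vld dd md].
Qed.

(** Once every dart is matched, the image of [f] is closed under rotation and reversal, hence is
    everything. *)
Lemma map_onto z : exists2 d, d \in darts vs & f d = z.
Proof.
apply: (dart_ind HF (P := fun z => exists2 d, d \in darts vs & f d = z) (d0 := f root)).
- by exists root; first exact: (v_root vld).
- by move=> _ [d dd <-]; exists (rotp d); rewrite ?darts_rot ?(emb_rot emb).
- move=> _ [d dd <-]; have [d' md] := all_mated dd; have [_ _ fd'] := emb_mate emb md.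
  by exists d'; first exact: (mate_dart emb md).
Qed.

Lemma face_walk_some n j x c : c \in darts vs -> x \in darts vs ->
    iter j.+1 phi (f c) = f x -> j <= n ->
  exists l, face_walk n m x c = Some l.
Proof.
elim: n j c => [|n IH] j c cd xd jE jn /=; have [d md] := all_mated cd; rewrite md;
  have dd := darts_rot (mate_dart emb md); case: eqP => [_|dx]; try by exists [:: c].
  case: dx; apply: (emb_inj emb) => //; rewrite (mate_next emb md) -jE.
  by move: jn; rewrite leqn0 => /eqP->.
case: j jE jn => [jE _|j jE jn].
  by case: dx; apply: (emb_inj emb) => //; rewrite (mate_next emb md) -jE.
have [|l ->] := IH j _ dd xd _ jn; last by exists (c :: l).
by rewrite (mate_next emb md) -iterSr.
Qed.

Lemma hexagon_at_some d : d \in darts vs -> #|porbit phi (f d)| = 6 -> exists l,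
    hexagon_at m d = Some l.
Proof.
move=> dd c6; have [|l fl] := @face_walk_some 5 5 d d dd dd _ isT.
  by have := iter_porbit phi (f d); rewrite c6.
exists l; rewrite /hexagon_at /face fl; have [_ -> _] := faceP HF emb fl.
by rewrite c6.
Qed.

Definition facet (l : seq positive) : {set dart F} := [set z in map f l].

Definition is_hexagon l := exists d, hexagon_at m d = Some l.

Lemma facetE d l : hexagon_at m d = Some l -> facet l = porbit phi (f d).
Proof. by move=> hd; have [_ _ pl _ _] := hexagon_atP HF emb hd; apply/setP => z;
    rewrite inE pl. Qed.

Lemma hexagons_of_hexagon l : l \in hexagons_of m vs -> is_hexagon l.
Proof.
rewrite mem_pmap => /mapP[d _]; case hd: (hexagon_at m d) => [l'|//];
    case: ifP => // _ [->].
by exists d.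
Qed.

Lemma hexagons_of_all c : c \in hexagons F -> exists2 l, l \in hexagons_of m vs &
    facet l = c.
Proof.
rewrite inE => /andP[/imsetP[z _ ->] /eqP c6].
have [d0 d0d d0z] := map_onto z; rewrite -d0z in c6 *.
have [l0 hl0] := hexagon_at_some d0d c6; have [_ _ p0 s0 sub0] := hexagon_atP HF emb hl0.
have [|d dl ld] := @exists_lowest l0; first by case: l0 s0 {hl0 p0 sub0}.
have po : porbit phi (f d) = porbit phi (f d0).
  by apply/eqP; rewrite eq_porbit_mem p0 map_f.
have [|l hl] := hexagon_at_some (sub0 d dl); first by rewrite po.
have [_ _ pl sl subl] := hexagon_atP HF emb hl.
exists l; last by rewrite (facetE hl) po.
rewrite mem_pmap; apply/mapP; exists d; first exact: sub0.
rewrite hl ifT //; apply/allP => b bl; apply: (allP ld).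
have : f b \in map f l0 by rewrite -p0 -po pl map_f.
case/mapP=> b' b'l0 /(emb_inj emb) -> //; [exact: subl | exact: sub0].
Qed.

Lemma disjoint_fromP l l' : is_hexagon l -> is_hexagon l' ->
  ~~ disjoint_from l l' -> ~~ [disjoint face_vertices (facet l) & face_vertices (facet l')].
Proof.
move=> [d hd] [d' hd']; rewrite negbK => /hasP[v /mapP[a al ->] /mapP[b bl E]].
have [_ _ _ _ sub] := hexagon_atP HF emb hd; have [_ _ _ _ sub'] := hexagon_atP HF emb hd'.
apply/pred0Pn; exists (dtail (f a)); apply/andP; split.
  by apply: imset_f; rewrite inE map_f.
rewrite (_ : dtail (f a) = dtail (f b)); first by apply: imset_f; rewrite inE map_f.
by apply/eqP; rewrite -(vert_dtail HF emb (sub _ al) (sub' _ bl)); apply/eqP.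
Qed.

(** * Soundness of the tests on complete maps *)

Lemma matchedP M d : all (fun d => mate m d != None) M -> d \in M ->
  exists d', [/\ mate m d = Some d', d \in darts vs, d' \in darts vs & f d' = e (f d)].
Proof.
move=> aM dM; have := allP aM d dM; case md: (mate m d) => [d'|//] _.
by exists d'; have [dd _ fd'] := emb_mate emb md; split=> //; apply: (mate_dart emb md).
Qed.

Definition matching_of (M : seq positive) : {set {set F}} :=
    [set E in map (fun d => edge_of (f d)) M].

Lemma perfect_matching_of M : perfect m vs M -> perfect_matching (matching_of M).
Proof.
case/and3P=> aM uM cM.
have endsE a d : a \in darts vs -> d \in M ->
    (dtail (f a) \in edge_of (f d)) = (vert a \in ends m d).
  move=> ad dM; have [d' [md dd d'd fd']] := matchedP aM dM.
  by rewrite /ends md !inE -dtail_drev -fd' !(vert_dtail HF emb).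
split.
  by apply/subsetP => E; rewrite inE edgesE => /mapP[d _ ->]; apply: imset_f.
move=> x; have [z zx] : exists z : dart F, dtail z = x.
  have [_ /(_ x) c _ _] := HF; have /card_gt0P[y] : 0 < #|[set y | adj x y]| by rewrite c.
  by rewrite inE => /adj_dart[z zx _]; exists z.
have [a ad az] := map_onto z; subst z; subst x.
have /allP/(_ (vert a)) := cM; have : vert a \in vs by move: ad;
    rewrite mem_darts => /andP[].
move=> -> /(_ isT)/flatten_mapP[d dM da].
apply/eqP/cards1P; exists (edge_of (f d)); apply/setP => E; rewrite !inE.
apply/andP/eqP => [[/mapP[d' d'M ->]]|->]; last first.
  by split; [exact: (map_f (fun d => edge_of (f d)) dM) | rewrite (endsE a d)].
by rewrite (endsE a d') // => da'; rewrite (uniq_flatten_map uM d'M dM da' da).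
Qed.

Lemma in_matchingP M d : all (fun d => mate m d != None) M -> d \in darts vs ->
  (edge_of (f d) \in matching_of M) = in_matching m M d.
Proof.
move=> aM dd; have [d' md] := all_mated dd; have d'd := mate_dart emb md.
have [_ _ fd'] := emb_mate emb md; rewrite inE /in_matching md.
apply/mapP/orP => [[a aM' /edge_of_eq[]]|[dM|d'M]].
- have [_ [_ ad _ _]] := matchedP aM aM'.
  by move/(emb_inj emb) => E; left; rewrite -E.
- have [_ [_ ad _ _]] := matchedP aM aM'.
  by rewrite -fd' => /(emb_inj emb) E; right; rewrite -E.
- by exists d.
- by exists d'; rewrite // fd' edge_of_drev.
Qed.

Lemma alternates_facet M l : all (fun d => mate m d != None) M -> is_hexagon l ->
  alternates m M l -> alternating (matching_of M) (facet l).
Proof.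
move=> aM [d hd]; have [ml _ pl sl sub] := hexagon_atP HF emb hd.
rewrite /alternates.
have eE a : a \in l -> (edge_of (f a) \in matching_of M) = in_matching m M a.
  by move=> al; apply: in_matchingP aM (sub a al).
have c6 : #|porbit phi (f d)| = 6 by have [_ + _ _ _] := hexagon_atP HF emb hd;
    rewrite inE => /andP[_ /eqP].
have := iter_porbit phi (f d); rewrite c6.
case: l sl ml sub eE {hd pl} => [|a0 [|a1 [|a2 [|a3 [|a4 [|a5 [|]]]]]]] // _ [] e0 e1 e2 e3
    e4 e5 sub eE p6.
move=> alt z; rewrite inE /= => zl.
have [[a b] [ab za zb]] : exists ab : positive * positive,
    [/\ ab \in [:: (a0, a1); (a1, a2); (a2, a3); (a3, a4); (a4, a5); (a5, a0)],
        z = f ab.1 & phi z = f ab.2].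
  move: zl; rewrite !inE; do 5?[case/orP]; move/eqP->.
  - by exists (a0, a1); rewrite !inE eqxx e1 e0.
  - by exists (a1, a2); rewrite !inE eqxx ?orbT e1 e2.
  - by exists (a2, a3); rewrite !inE eqxx ?orbT e2 e3.
  - by exists (a3, a4); rewrite !inE eqxx ?orbT e3 e4.
  - by exists (a4, a5); rewrite !inE eqxx ?orbT e4 e5.
  - by exists (a5, a0); rewrite !inE eqxx ?orbT /= e5 e0; split=> //; exact: p6.
rewrite zb za /= in ab *.
have [al bl] : a \in [:: a0; a1; a2; a3; a4; a5] /\ b \in [:: a0; a1; a2; a3; a4; a5].
  by move: ab; rewrite !inE !xpair_eqE; do 5?[case/orP]; case/andP=> /eqP-> /eqP->;
      rewrite !eqxx ?orbT.
rewrite !eE //; move: ab; rewrite !inE !xpair_eqE.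
by case/orP: alt => /eqP[m0 m1 m2 m3 m4 m5]; do 5?[case/orP]; case/andP=> /eqP-> /eqP->;
    rewrite ?m0 ?m1 ?m2 ?m3 ?m4 ?m5.
Qed.
(** One matching alternating on all of [H ++ L] serves every [C] drawn from it. Otherwise the
    recursion branches on whether [h] belongs to [C]; if it does, the hexagons meeting [h] can be
    discarded. *)
Lemma resonantP n H L (C : {set {set dart F}}) : resonant n m vs H L ->
  (forall l, l \in H ++ L -> is_hexagon l) -> disjoint_hexagons C -> 4 <= #|C| ->
  (forall c, c \in C -> exists2 l, l \in H ++ L & facet l = c) -> resonant_pattern C.
Proof.
elim: n H L => [//|n IH] H L /=; case: ifP => [small _ _ _ c4 cov|_].
  suff : #|C| < 4 by rewrite ltnNge c4.
  apply: leq_ltn_trans small; rewrite -size_cat -(size_map facet);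
      apply: leq_trans (card_size _).
  by apply: subset_leq_card; apply/subsetP => c /cov[l lHL <-]; apply: map_f.
case: ifP => [|_].
  rewrite /certified; case: (matching 100 m (uncovered vs H)) => [M0|//];
      case: ifP => // /allP al pM _ hex dC _ cov.
  split=> //; exists (matching_of (flatten (map evens H) ++ M0));
      first exact: (perfect_matching_of pM).
  move=> c /cov[l lHL <-]; apply: alternates_facet (hex l lHL) (al l lHL).
  by case/and3P: pM.
case: L => [//|h L]; case: ifP => // rh rL hex dC c4 cov.
have hexh : is_hexagon h by apply: hex; rewrite mem_cat inE eqxx orbT.
case: (boolP (facet h \in C)) => hC.
  apply: (IH _ _ rh _ dC c4) => [l|c cC].
    rewrite mem_cat inE mem_filter => lm; apply: hex; rewrite mem_cat inE.
    by case/orP: lm => [/orP[->|->]|/andP[_ ->]]; rewrite ?orbT.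
  have [l] := cov c cC; rewrite mem_cat inE => lm lc.
  case: (boolP (c == facet h)) => [/eqP->|ch]; first by exists h;
      rewrite // mem_cat inE eqxx.
  exists l => //; rewrite mem_cat inE mem_filter.
  case/or3P: lm => [->|/eqP lh|lL]; first by rewrite orbT.
    by rewrite -lc lh eqxx in ch.
  rewrite lL andbT; apply/orP; right; apply: contraT => nd.
  have hexl : is_hexagon l by apply: hex; rewrite mem_cat inE lL !orbT.
  case/negP: (disjoint_fromP hexh hexl nd); rewrite lc.
  by have [_ dis] := dC; apply: dis; rewrite // eq_sym.
apply: (IH _ _ rL _ dC c4) => [l|c cC].
  by rewrite mem_cat => lm; apply: hex; rewrite mem_cat inE; case/orP: lm => ->;
      rewrite ?orbT.
have [l] := cov c cC; rewrite mem_cat inE => lm lc; exists l => //; rewrite mem_cat.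
by case/or3P: lm => [->|/eqP lh|->] //; rewrite ?orbT //; rewrite -lc lh (negPf hC) in cC.
Qed.

Lemma odd_componentP H : odd_component m vs H -> (forall l, l \in H -> is_hexagon l) ->
  apart_hexagons m (map (map vert) H) -> size H <= 3 -> False.
Proof.
rewrite /odd_component; case: (uncovered vs H) => [//|v0 _]; cbv zeta.
set u := map vert (flatten H); move: (component _ _ _ _ _) => c.
case/and4P=> oc uc /allP cu /allP cc hex aH sH.
have [|M pM rM] := resonant_matching HF res3 emb aH; first by rewrite size_map.
have uE v : v \in u -> exists2 h, h \in map (map vert) H & v \in h.
  by case/mapP=> d /flattenP[l lH dl] ->; exists (map vert l); rewrite map_f.
have cd d : d \in darts c -> d \in darts vs.
  by move/cc; case md: (mate m d) => [d'|//] _; have [] := emb_mate emb md.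
have stay d d' : d \in darts c -> mate m d = Some d' -> edge_of (f d) \in M ->
    vert d' \in c.
  move=> dc md dM; have := cc d dc; rewrite md => /orP[//|/uE[h hH d'h]].
  have d'd := mate_dart emb md; have [dd _ fd'] := emb_mate emb md.
  have [|b bd [bh bt]] := rM h hH d' d'd _ d'h; first by rewrite fd' edge_of_drev.
  have vb : vert d = vert b by apply/eqP; rewrite (vert_dtail HF emb) // bt fd' dhead_drev.
  move: dc; rewrite mem_darts vb => /andP[/cu/negP[]]; move/mapP: hH => [l lH hl].
  by move: bh; rewrite hl => /mapP[a al ->]; apply: map_f; apply/flattenP; exists l.
(* The parity argument on darts: [D] is closed under reversal, so its size is even, while each
   vertex of [c] is the tail of exactly one dart of [D]. *)
pose D := [set z : dart F | (edge_of z \in M) && (z \in map f (darts c))].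
have Drev z : z \in D -> e z \in D.
  rewrite !inE edge_of_drev => /andP[zM /mapP[d dc zd]]; rewrite zM /= zd.
  have [d' md] := all_mated (cd d dc); have [_ _ <-] := emb_mate emb md; apply: map_f.
  have := mate_dart emb md; rewrite !mem_darts => /andP[_ ->]; rewrite andbT.
  by apply: (stay d) md _; rewrite // -zd.
have evenD : ~~ odd #|D|.
  rewrite (card_const_fibers_in (f := @edge_of F) (k := 2)) ?muln2 ?odd_double // => z zD.
  rewrite (_ : [set _ in D | _] = [set z; e z]) ?cards2 1?eq_sym ?drev_neq //.
  apply/setP => y; rewrite !inE; apply/andP/orP => [[_ /eqP/esym/edge_of_eq[]->]|[]/eqP->];
      auto.
    by have := zD; rewrite inE => ->.
  by have := Drev z zD; rewrite inE => ->; rewrite edge_of_drev.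
have cardD : #|D| = size c.
  pose g v := dtail (f (dart0 v)).
  have c0 v : v \in c -> dart0 v \in darts c by move=> vc; rewrite mem_darts /= vc inE eqxx.
  have uniq_g : uniq (map g c).
    rewrite map_inj_in_uniq // => v w vc wc /eqP.
    by rewrite -(vert_dtail HF emb) ?cd ?c0 // => /eqP.
  rewrite -(size_map g) -(card_uniqP uniq_g) -(card_in_imset (f := @dtail F)) => [|y z];
      last first.
    by rewrite !inE => /andP[yM _] /andP[zM _]; apply: (matching_inj pM).
  apply: eq_card => x; apply/imsetP/mapP => [[z]|[v vc ->]].
    rewrite inE => /andP[_ /mapP[d dc ->]] ->; exists (vert d).
      by move: dc; rewrite mem_darts => /andP[].
    apply/eqP; have vc : vert d \in c by move: dc; rewrite mem_darts => /andP[].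
    by rewrite /g -(vert_dtail HF emb) ?cd ?c0.
  have [z zt zM] := matching_dart pM (g v); exists z; last by rewrite zt.
  rewrite inE zM /=; have [d dd dz] := map_onto z; rewrite -dz; apply: map_f.
  rewrite -dz in zt; have vd : vert d = v.
    apply/eqP; rewrite -[X in _ == X]/(vert (dart0 v)) (vert_dtail HF emb dd (cd _ (c0 v
        vc))); exact/eqP.
  by move: dd; rewrite !mem_darts => /andP[_ ->]; rewrite andbT vd.
by move: evenD; rewrite cardD oc.
Qed.

Lemma beltP n k H L : belt n m vs k H L -> (forall l, l \in H ++ L -> is_hexagon l) ->
  pairwise apart (map (map vert) H) -> (forall h l, h \in H -> l \in L ->
      disjoint_from h l) ->
  size H + k <= 2 -> False.
Proof.
elim: n k H L => [//|n IH] k H [//|h L] /=.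
case: ifP => [b _|_ b] hex pH HL s2.
  have pH' : pairwise apart (map (map vert) (h :: H)).
    rewrite /= pH andbT; apply/allP => _ /mapP[l lH ->]; rewrite apart_sym.
    by apply: HL; rewrite // inE eqxx.
  case: k b s2 => [|k] b s2.
    apply: (odd_componentP b); last by rewrite /=; lia.
      by move=> l lm; apply: hex; move: lm; rewrite mem_cat !inE => /orP[]->; rewrite ?orbT.
    split=> // _ /mapP[l lm ->].
    have [|d hd] := hex l; first by move: lm; rewrite mem_cat !inE => /orP[]->;
        rewrite ?orbT.
    by exists d, l.
  apply: (IH _ _ _ b) => [|||/=]; [|exact: pH'| |lia].
    move=> l; rewrite mem_cat inE mem_filter => lm; apply: hex; rewrite mem_cat inE.
    by case/orP: lm => [/orP[->|->]|/andP[_ ->]]; rewrite ?orbT.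
  move=> h' l; rewrite inE mem_filter => /predU1P[->|h'H] /andP[dl lL] //.
  by apply: HL; rewrite // inE lL orbT.
apply: (IH _ _ _ b) => // [l|h' l h'H lL].
  by rewrite mem_cat => lm; apply: hex; rewrite mem_cat inE; case/orP: lm => ->;
      rewrite ?orbT.
by apply: HL; rewrite // inE lL orbT.
Qed.

Lemma leafP : leaf m vs ->
  forall C : {set {set dart F}}, disjoint_hexagons C -> 4 <= #|C| -> resonant_pattern C.
Proof.
rewrite /leaf; case: ifP => [/hasP[d dd]|_];
    first by rewrite (chain_fromP HF res3 emb _ dd).
case: ifP => [b|_] res C dC c4.
  by case: (beltP b) => // l /hexagons_of_hexagon.
apply: (resonantP res _ dC c4) => [l /hexagons_of_hexagon//|c cC].
by apply: hexagons_of_all; apply: (subsetP dC.1).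
Qed.
End Leaf.

(* The search passes through about 20000 partial maps and 200 complete ones. *)
Lemma run_leaf :
  search (dart0 1) leaf 200 (PositiveMap.empty _) 2 [:: 1%positive] init_regions.
Proof. vm_cast_no_check (erefl true). Qed.

Lemma valid_init (F : plane_graph) (HF : fullerene F) (z : dart F) :
  #|porbit (next_dart F) z| = 5 ->
  valid (dart0 1) (PositiveMap.empty _) 2 [:: 1%positive] init_regions
    (extend_map (fun=> z) 1%positive z).
Proof.
move=> z5; set g := extend_map _ _ _.
have none d : mate (PositiveMap.empty _) d = None by apply: PositiveMap.gempty.
have g0 : g (dart0 1) = z by [].
have g1 : g (dart1 1) = rotation F z by [].
have g2 : g (dart2 1) = rotation F (rotation F z) by [].
have rn := rotation_uniq HF z; rewrite /= !inE negb_or andbT in rn;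
    case/andP: rn => /andP[r1 r2] r3.
have dE : darts [:: 1%positive] = [:: dart0 1; dart1 1; dart2 1] by [].
split.
- split=> [a b|d|d d']; rewrite ?none // dE.
    rewrite !inE => /or3P[]/eqP-> /or3P[]/eqP->; rewrite ?g0 ?g1 ?g2 // => /eqP;
    by rewrite ?(negPf r1) ?(negPf r2) ?(negPf r3) // eq_sym ?(negPf r1) ?(negPf r2)
        ?(negPf r3).
  rewrite !inE => /or3P[]/eqP->; [by rewrite g0 | by rewrite g1 |].
  by rewrite g2 rotation3.
- by move=> v; rewrite inE => /eqP->.
- by move=> d; rewrite dE.
- by move=> d; rewrite dE.
- by [].
- by move=> q; rewrite inE => /eqP->.
- move=> d; rewrite dE !inE => /or3P[]/eqP->; rewrite g0 ?g1 ?g2.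
  + exact: connect0.
  + exact: conn_rot.
  + by apply: connect_trans (conn_rot _ _ _ _) (conn_rot _ _ _ _).
- by [].
- by rewrite g0.
Qed.

Theorem theorem5p8 (F : plane_graph) (HF : fullerene F) :
  k_resonant F 3 <-> (forall k : nat, 3 <= k -> k_resonant F k).
Proof.
split=> [res3 k _ i ik H dH Hi|]; last by apply.
move: Hi; case: (leqP i 3) => i3 Hi; first exact: res3 i3 H dH Hi.
(* The twelve pentagons serve here only to supply a dart [z] of a pentagon, as the root of the
   search. *)
have [_ _ p12 _] := HF; have /card_gt0P[c] : 0 < #|pentagons F| by rewrite p12.
rewrite inE => /andP[/imsetP[z _ ->] /eqP z5].
have leaf_res m nx vs (f : positive -> dart F) : valid (dart0 1) m nx vs [::] f ->
    leaf m vs -> 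
  forall C : {set {set dart F}}, disjoint_hexagons C -> 4 <= #|C| -> resonant_pattern C.
  by move=> v; exact: (leafP HF res3 v).
have := searchP HF res3 leaf_res run_leaf (valid_init HF z5); apply=> //; by rewrite Hi.
Qed.
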